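(* Let $m\in\mathbb N$. A complete vertex description of the cone of squared feasible pairs $\mathcal F^2_{m,(m,m^2)}$ is given by the entrywise squares of the elements of $$\mathcal V=\Big\{(\widetilde\gamma,\widetilde\theta)\in\mathcal F_{m,(m,m^2)}\ \Big|\ \widetilde\gamma_+^2=\big((m\beta)_{\#k},\,\alpha_{\#\beta}\big),\ \widetilde\theta_+^2=\big(\beta_{\#mk},\,\beta_{\#\alpha}\big),\ k\in\{0,\dots,m-\beta\},\ \alpha,\beta\in\mathbb N,\ \beta\le m,\ \alpha\le\beta m,\ \text{and } k=0\text{ if }\alpha=\beta m\Big\}.$$ That is, $\mathcal F^2_{m,(m,m^2)}$ is the convex cone generated by $\{(\widetilde\gamma^2,\widetilde\theta^2)\mid(\widetilde\gamma,\widetilde\theta)\in\mathcal V\}$, and its extreme rays are exactly the rays spanned by the elements of this set.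
   Context: $\mathbb N=\{1,2,\dots\}$. For $a,b\in\mathbb N\cup\{0\}$, $a_{\#b}=(a,\dots,a)$ denotes the tuple of length $b$ with all entries $a$ (empty if $b=0$); commas denote concatenation. $\mathcal D^n_{\ge0}$ is the set of weakly decreasing $n$-tuples of non-negative reals, $\mathcal D^\infty_{\ge0}$ the set of weakly decreasing sequences of non-negative reals with finitely many nonzero entries; $v_+$ is the tuple of positive entries of $v$ and $\deg(v)$ its length; squares are entrywise. $\mathbb K\in\{\mathbb R,\mathbb C\}$. A pair $(\gamma,\theta)\in\mathcal D^\infty_{\ge0}\times\mathcal D^\infty_{\ge0}$ is feasible for $m$ if there is a tensor $A\in\mathbb K^{\deg(\gamma)\times m\times\deg(\theta)}$ whose matricizations $A^{(\{1\})}\in\mathbb K^{\deg(\gamma)\times m\deg(\theta)}$ and $A^{(\{1,2\})}\in\mathbb K^{\deg(\gamma)m\times\deg(\theta)}$ have singular values (sorted weakly decreasingly, extended by zeros) $\gamma$ and $\theta$, respectively (a tensor with a mode of size $0$ is understood to have only zero singular values). $\mathcal F_{m,(r_1,r_2)}$ is the set of pairs $(\widetilde\gamma,\widetilde\theta)\in\mathcal D^{r_1}_{\ge0}\times\mathcal D^{r_2}_{\ge0}$ for which $((\widetilde\gamma,0,\dots),(\widetilde\theta,0,\dots))$ is feasible for $m$, and $\mathcal F^2_{m,(r_1,r_2)}=\{(\widetilde\gamma_1^2,\dots,\widetilde\gamma_{r_1}^2,\widetilde\theta_1^2,\dots,\widetilde\theta_{r_2}^2)\mid(\widetilde\gamma,\widetilde\theta)\in\mathcal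 F_{m,(r_1,r_2)}\}\subset\mathbb R^{r_1+r_2}$; this is a closed, convex, polyhedral cone. *)

(* Defs.v *)
From HB Require Import structures.
From mathcomp Require Import all_boot all_order all_algebra.
From mathcomp Require Import finmap complex.
From mathcomp Require Import mathcomp_extra boolp classical_sets cardinality.
From mathcomp Require Import reals.

Set Implicit Arguments.
Unset Strict Implicit.
Unset Printing Implicit Defensive.

Import Order.TTheory GRing.Theory Num.Theory.
Local Open Scope classical_set_scope.
Local Open Scope ring_scope.
Local Open Scope complex_scope.

Variant scalar_kind := RealScalars | ComplexScalars.

Definition scalar_field (R : realType) (K : scalar_kind) : numFieldType :=
  match K with RealScalars => R | ComplexScalars => R[i] end.

Definition scalar_of_real (R : realType) (K : scalar_kind) : R -> scalar_field R K :=
  match K return R -> scalar_field R K with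
  | RealScalars => id
  | ComplexScalars => fun x => x%:C
  end.

Definition scalar_conj (R : realType) (K : scalar_kind) :
    scalar_field R K -> scalar_field R K :=
  match K return scalar_field R K -> scalar_field R K with
  | RealScalars => id
  | ComplexScalars => @conjc R
  end.

Definition conj_transpose (R : realType) (K : scalar_kind) p q
    (A : 'M[scalar_field R K]_(p, q)) : 'M[scalar_field R K]_(q, p) :=
  (map_mx (@scalar_conj R K) A)^T.

(* Tuples and sequences are indexed from 0. *)

Definition decr_tuples (R : realType) (n : nat) : set (n.-tuple R) :=
  [set v | sorted >=%R v /\ all (fun x => 0 <= x) v].

Definition decr_seqs (R : realType) : set (nat -> R) :=
  [set v | [/\ (forall i j, (i <= j)%N -> v j <= v i),
               (forall i, 0 <= v i) &
               finite_set [set i | v i != 0]]].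

Definition deg (R : realType) (v : nat -> R) : nat :=
  #|` fset_set [set i | 0 < v i]|.

Definition zero_extension (R : realType) n (v : n.-tuple R) : nat -> R :=
  fun i => nth 0 v i.

(* [s] lists the singular values of [A] in weakly decreasing order, followed
   by zeros: their squares are the eigenvalues of A A^*, with multiplicity.
   If p = 0 or q = 0 this forces [s] to vanish identically. *)
Definition has_singular_values (R : realType) (K : scalar_kind) p q
    (A : 'M[scalar_field R K]_(p, q)) (s : nat -> R) : Prop :=
  [/\ (forall i j, (i <= j)%N -> s j <= s i),
      (forall i, 0 <= s i),
      (forall i, (minn p q <= i)%N -> s i = 0) &
      char_poly (A *m conj_transpose A) =
        \prod_(i < p) ('X - (@scalar_of_real R K (s i ^+ 2))%:P)].

Definition tensor (T : Type) (p m q : nat) := 'I_p -> 'I_m -> 'I_q -> T.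

Definition matricization1 (T : Type) p m q (A : tensor T p m q) :
    'M[T]_(p, m * q) :=
  \matrix_(i < p) mxvec (\matrix_(j < m, k < q) A i j k).

Definition matricization12 (T : Type) p m q (A : tensor T p m q) :
    'M[T]_(p * m, q) :=
  (\matrix_(k < q) mxvec (\matrix_(i < p, j < m) A i j k))^T.

Definition feasible (R : realType) (K : scalar_kind) (m : nat)
    (g t : nat -> R) : Prop :=
  [/\ decr_seqs g, decr_seqs t &
      exists A : tensor (scalar_field R K) (deg g) m (deg t),
        has_singular_values (matricization1 A) g /\
        has_singular_values (matricization12 A) t].

Definition feasible_pairs (R : realType) (K : scalar_kind) (m r1 r2 : nat) :
    set (r1.-tuple R * r2.-tuple R) :=
  [set gt | [/\ decr_tuples gt.1, decr_tuples gt.2 &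
                feasible K m (zero_extension gt.1) (zero_extension gt.2)]].

Definition squared_pair (R : realType) r1 r2
    (gt : r1.-tuple R * r2.-tuple R) : 'rV[R]_(r1 + r2) :=
  \row_(i < r1 + r2) tnth (cat_tuple gt.1 gt.2) i ^+ 2.

Definition squared_feasible (R : realType) (K : scalar_kind) (m r1 r2 : nat) :
    set 'rV[R]_(r1 + r2) :=
  @squared_pair R r1 r2 @` @feasible_pairs R K m r1 r2.

Definition pos_part_sq (R : realType) n (v : n.-tuple R) : seq R :=
  [seq x ^+ 2 | x <- v & 0 < x].

Definition vertex_pairs (R : realType) (K : scalar_kind) (m : nat) :
    set (m.-tuple R * (m ^ 2).-tuple R) :=
  [set gt | @feasible_pairs R K m m (m ^ 2) gt /\
    exists k a b : nat,
      [/\ (0 < a)%N, (0 < b <= m)%N, (a <= b * m)%N & (k <= m - b)%N] /\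
      [/\ a = (b * m)%N -> k = 0%N,
          pos_part_sq gt.1 = nseq k (m * b)%:R ++ nseq b a%:R &
          pos_part_sq gt.2 = nseq (m * k) b%:R ++ nseq a b%:R]].

Definition conic_hull (R : realType) n (S : set 'rV[R]_n) : set 'rV[R]_n :=
  [set x | exists (l : nat) (c : 'I_l -> R) (v : 'I_l -> 'rV[R]_n),
     [/\ (forall i, 0 <= c i), (forall i, S (v i)) & x = \sum_i c i *: v i]].

Definition ray (R : realType) n (v : 'rV[R]_n) : set 'rV[R]_n :=
  [set x | exists2 c : R, 0 <= c & x = c *: v].

Definition extreme_ray (R : realType) n (C r : set 'rV[R]_n) : Prop :=
  [/\ (exists2 v : 'rV[R]_n, v != 0 & r = ray v),
      r `<=` C &
      forall x y, C x -> C y -> r (x + y) -> r x /\ r y].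

(* Main.v *)
Require Import Defs.
From HB Require Import structures.
From mathcomp Require Import all_boot all_order all_algebra.
From mathcomp Require Import fingroup perm.
From mathcomp Require Import finmap complex.
From mathcomp Require Import classical_sets boolp cardinality reals.
From mathcomp Require Import ring lra zify.

(** Squaring turns the singular values of the two matricizations into the
    eigenvalues [g] and [t] of the Gram matrices of the slices [A_j] of the
    tensor, [\sum_j A_j A_j^*] and [\sum_j A_j^* A_j].  The proof identifies the
    cone of squared feasible pairs with an explicit polyhedral cone: both halves
    decrease weakly and are nonnegative, they have the same sum, and

      [\sum_(i < n) g i <= \sum_(i < m * n) t i]  for every [n].

    Necessity ([prefix_sums_le], [feasible_necessary]).  Compress the first mode
    to the span of the top [n] eigenvectors of the first Gram matrix.  The rows
    of the compressed slices span at most [m * n] dimensions and carry the mass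
    on the left, while Ky Fan's inequality bounds the mass that the second Gram
    matrix has in so few dimensions by the right-hand side.

    Sufficiency ([feasible_sufficient]).  Cut [t] into [m] consecutive blocks of
    length [m].  The inequalities say that [g] is majorised by the sequence of
    block sums, so the Schur-Horn theorem gives an orthogonal matrix whose squared
    entries distribute the block sums into [g].  Spreading row [l] of this matrix,
    scaled by the square root of [t (l * m + s)], along the [s]-th cyclic diagonal
    of an [m] by [m] square gives slices that are orthogonal to each other, and
    whose rows in the first mode are orthogonal as well; thus both Gram matrices
    are diagonal with the prescribed entries.

    Polyhedral part.  A point [x] of the cone is decomposed by subtracting
    multiples of generators that lie on every facet through [x]
    ([facet_cone_generated]); [vertex_in_face] finds such a vertex by looking at
    the last index before the end of [g] at which the prefix inequality is tight.
    Conversely the facets through a vertex intersect in its ray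
    ([vertex_face_ray]), so each vertex is extreme, and in a cone generated by the
    vertices no other ray can be extreme ([extreme_ray_generator]). *)

Set Implicit Arguments.
Unset Strict Implicit.
Unset Printing Implicit Defensive.

Import Order.TTheory GRing.Theory Num.Theory.
Local Open Scope classical_set_scope.
Local Open Scope ring_scope.

(** * Characteristic polynomials of products *)

(** Both sides are the determinant of the block matrix [[x, a], [b, 1]], up to
    a triangular factor. *)
Lemma det_scalar_sub_mulmxC (F : comNzRingType) p q (x : F)
    (a : 'M[F]_(p, q)) (b : 'M_(q, p)) :
  \det (x%:M - a *m b) * x ^+ q = \det (x%:M - b *m a) * x ^+ p.
Proof.
pose N := block_mx x%:M a b 1%:M : 'M_(p + q).
have <- : \det N = \det (x%:M - a *m b).
  have : N *m block_mx 1%:M 0 (- b) 1%:M = block_mx (x%:M - a *m b) a 0 1%:M.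
    by rewrite mulmx_block !mulmx1 !mulmx0 mulmxN !mul1mx !add0r subrr.
  by move=> /(congr1 determinant); rewrite det_mulmx det_lblock det_ublock !det1 !mulr1.
have : block_mx 1%:M 0 (- b) x%:M *m N = block_mx x%:M a 0 (x%:M - b *m a).
  rewrite mulmx_block !mul1mx !mul0mx !mulmx1 !addr0 mulNmx mul_mx_scalar.
  by rewrite mul_scalar_mx addNr mulNmx [- _ + _]addrC.
move=> /(congr1 determinant); rewrite det_mulmx det_lblock det_ublock !det1 mul1r.
by rewrite !det_scalar mulrC => ->; rewrite mulrC.
Qed.

Lemma char_poly_mulmxC (F : comNzRingType) p q (A : 'M[F]_(p, q)) (B : 'M_(q, p)) :
  char_poly (A *m B) * 'X^q = char_poly (B *m A) * 'X^p.
Proof.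
by rewrite /char_poly /char_poly_mx !map_mxM det_scalar_sub_mulmxC.
Qed.

Lemma char_poly_diag (F : comNzRingType) n (d : 'I_n -> F) :
  char_poly (diag_mx (\row_i d i)) = \prod_(i < n) ('X - (d i)%:P).
Proof.
rewrite char_poly_trig ?diag_mx_is_trig //.
by apply: eq_bigr => i _; rewrite !mxE eqxx.
Qed.

(** The two products have the same nonzero eigenvalues; the zeros of [s] from
    [minn p q] on absorb the difference between their sizes. *)
Lemma char_poly_mulmxC_prod (F : fieldType) p q (A : 'M[F]_(p, q)) (B : 'M_(q, p))
    (s : nat -> F) :
  (forall i, (minn p q <= i)%N -> s i = 0) ->
  char_poly (A *m B) = \prod_(i < p) ('X - (s i)%:P) ->
  char_poly (B *m A) = \prod_(i < q) ('X - (s i)%:P).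
Proof.
move=> s0 E.
have pad a b : (minn p q <= a)%N ->
    \prod_(i < a) ('X - (s i)%:P) * 'X^b = \prod_(i < a + b) ('X - (s i)%:P).
  move=> la; rewrite big_split_ord /=; congr (_ * _).
  under eq_bigr => i _ do rewrite s0 ?subr0 ?(leq_trans la) ?leq_addr //.
  by rewrite prodr_const card_ord.
have := char_poly_mulmxC A B.
rewrite E pad ?geq_minl // addnC -pad ?geq_minr //.
by move/mulIf => ->//; rewrite expf_neq0 ?polyX_eq0.
Qed.

(** * Ky Fan's inequality and the prefix sums of a tensor *)

Section KyFan.
Variable C : numClosedFieldType.
Local Open Scope sesquilinear_scope.

(** Permuting the rows of a diagonalising matrix permutes the eigenvalues, so
    they can be taken in any prescribed order. *)
Lemma hermitian_diagonalization n (M : 'M[C]_n) (s : nat -> C) :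
  M ^t* = M -> char_poly M = \prod_(i < n) ('X - (s i)%:P) ->
  exists2 U : 'M[C]_n, U \is unitarymx &
    M = U ^t* *m diag_mx (\row_i s i) *m U.
Proof.
move=> hM cM.
have /orthomx_spectralP: M \is normalmx by apply/normalmxP; rewrite hM.
set P := spectralmx M; set D := spectral_diag M => eM.
have uP : P \is unitarymx by apply: spectral_unitarymx.
have /(congr1 char_poly) := eM; rewrite cM.
have -> : char_poly (invmx P *m diag_mx D *m P) = char_poly (diag_mx D).
  have := char_poly_mulmxC (invmx P *m diag_mx D) P.
  rewrite mulKVmx ?unitarymx_unit //; apply: mulIf.
  by rewrite expf_neq0 ?polyX_eq0.
have -> : D = \row_i D 0 i by apply/rowP=> i; rewrite mxE.
rewrite char_poly_diag.
pose sl := [tuple s i | i < n]; pose Dl := [tuple D 0 i | i < n].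
have -> : \prod_(i < n) ('X - (s i)%:P) = \prod_(x <- sl) ('X - x%:P).
  by rewrite big_tuple; apply: eq_bigr => i _; rewrite tnth_mktuple.
have -> : \prod_(i < n) ('X - (D 0 i)%:P) = \prod_(x <- Dl) ('X - x%:P).
  by rewrite big_tuple; apply: eq_bigr => i _; rewrite tnth_mktuple.
move=> /prod_XsubC_eq /tuple_permP [sg es].
have sE (i : 'I_n) : s i = D 0 (sg i).
  by have := congr1 (fun l => nth 0 l i) es; rewrite -!tnth_nth !tnth_mktuple.
have uS : perm_mx sg \is @unitarymx C n n.
  by apply/unitarymxP; rewrite tr_perm_mx map_perm_mx -perm_mxM mulgV perm_mx1.
exists (perm_mx sg *m P); first exact: mul_unitarymx.
have -> : diag_mx (\row_i s i) = perm_mx sg *m diag_mx D *m (perm_mx sg) ^t*.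
  rewrite tr_perm_mx map_perm_mx -row_permE -col_permE.
  by apply/matrixP=> i j; rewrite !mxE sE (inj_eq perm_inj).
rewrite trmx_mul map_mxM !mulmxA -[P ^t* *m _ *m _]mulmxA.
have /mulmx1C-> := unitarymxP uS.
by rewrite mulmx1 -[_ *m _ *m perm_mx sg]mulmxA (mulmx1C (unitarymxP uS)) mulmx1
  -invmx_unitary.
Qed.

(** The squared Frobenius norm. *)
Definition frob p q (X : 'M[C]_(p, q)) : C := \tr (X *m X ^t*).

Lemma frobE p q (X : 'M[C]_(p, q)) : frob X = \sum_i \sum_j `|X i j| ^+ 2.
Proof.
apply: eq_bigr => i _; rewrite mxE; apply: eq_bigr => j _.
by rewrite !mxE normCK.
Qed.

Lemma frob_unitary p q (U : 'M[C]_p) (X : 'M[C]_(p, q)) :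
  U \is unitarymx -> frob (U *m X) = frob X.
Proof.
move=> uU; rewrite /frob trmx_mul map_mxM mxtrace_mulC !mulmxA.
rewrite -[X ^t* *m _ *m U]mulmxA (mulmx1C (unitarymxP uU)) mulmx1.
by rewrite mxtrace_mulC.
Qed.

Lemma frob_pid p q n (X : 'M[C]_(p, q)) : frob (pid_mx n *m X : 'M_(p, q)) <= frob X.
Proof.
rewrite !frobE; apply: ler_sum => i _; apply: ler_sum => j _.
rewrite mxE (bigD1 i) //= big1 => [|k ki]; last first.
  by rewrite mxE eq_sym (inj_eq val_inj) (negPf ki) mul0r.
rewrite addr0 mxE eqxx /=; case: (_ < _)%N; first by rewrite mul1r.
by rewrite mul0r normr0 expr0n /= exprn_ge0.
Qed.

(** Weights between 0 and 1 of total mass at most [N] do best on the [N] largest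
    terms: measure every term relative to [t N], which makes the contributions of
    the later terms nonpositive. *)
Lemma weighted_sum_le_prefix q N (t : nat -> C) (c : 'I_q -> C) :
  (forall i j, (i <= j)%N -> t j <= t i) -> (forall i, 0 <= t i) ->
  (forall k, 0 <= c k <= 1) -> \sum_k c k <= N%:R ->
  \sum_(k < q) t k * c k <= \sum_(k < N) t k.
Proof.
move=> td t0 c01 cN.
have H : \sum_(k < q) (t k - t N) * c k <= \sum_(k < N) (t k - t N).
  apply: (@le_trans _ _ (\sum_(k < q | (k < N)%N) (t k - t N))).
    rewrite big_mkcond /= [leRHS]big_mkcond /=; apply: ler_sum => k _.
    have /andP[c0 c1] := c01 k; case: ltnP => kN.
      by rewrite ler_piMr // subr_ge0 td // ltnW.
    by rewrite mulr_le0_ge0 // subr_le0 td.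
  have pad a b (P : pred nat) : (a <= b)%N -> \sum_(k < a | P k) (t k - t N) =
      \sum_(k < b | P k && (k < a)%N) (t k - t N).
    by move=> ab; rewrite (big_ord_widen_cond b P (fun k => t k - t N) ab).
  rewrite (pad q (maxn q N) (fun k => (k < N)%N)) ?leq_maxl //.
  rewrite (big_ord_widen (maxn q N) (fun k => t k - t N)) ?leq_maxr //.
  rewrite big_mkcond /= [leRHS]big_mkcond /=; apply: ler_sum => k _.
  case: (ltnP k N) => //= kN; case: ifP => // _.
  by rewrite subr_ge0 td // ltnW.
have -> : \sum_(k < q) t k * c k = \sum_(k < q) (t k - t N) * c k + t N * \sum_k c k.
  by rewrite mulr_sumr -big_split; apply: eq_bigr => k _ /=; rewrite mulrBl subrK.
have -> : \sum_(k < N) t k = \sum_(k < N) (t k - t N) + t N * N%:R.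
  by rewrite sumrB sumr_const card_ord mulr_natr subrK.
by rewrite lerD // ler_wpM2l.
Qed.

(** Ky Fan's inequality.  In an eigenbasis of [M] the trace is a weighted sum of
    the eigenvalues; the weights are the diagonal entries of an orthogonal
    projection of rank [r], hence lie between 0 and 1 and add up to [r]. *)
Lemma ky_fan q r N (M : 'M[C]_q) (t : nat -> C) (V : 'M[C]_(r, q)) :
  M ^t* = M -> char_poly M = \prod_(i < q) ('X - (t i)%:P) ->
  (forall i j, (i <= j)%N -> t j <= t i) -> (forall i, 0 <= t i) ->
  V \is unitarymx -> (r <= N)%N ->
  \tr (V *m M *m V ^t*) <= \sum_(k < N) t k.
Proof.
move=> hM cM td t0 uV rN; have [U uU ->] := hermitian_diagonalization hM cM.
pose Y := V *m U ^t*.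
have uY : Y \is unitarymx by rewrite mul_unitarymx // trmxC_unitary.
pose P := Y ^t* *m Y.
have hP : P ^t* = P by rewrite /P trmx_mul map_mxM trmxCK.
have PP : P *m P = P by rewrite /P mulmxA -[Y ^t* *m _ *m _]mulmxA (unitarymxP uY) mulmx1.
have -> : V *m (U ^t* *m diag_mx (\row_i t i) *m U) *m V ^t* =
    Y *m diag_mx (\row_i t i) *m Y ^t*.
  by rewrite /Y trmx_mul map_mxM trmxCK !mulmxA.
rewrite mxtrace_mulC mulmxA mxtrace_mulC.
have -> : \tr (diag_mx (\row_i t i) *m P) = \sum_(k < q) t k * P k k.
  by apply: eq_bigr => k _; rewrite mul_diag_mx !mxE.
have PE k : P k k = \sum_j `|P k j| ^+ 2.
  rewrite -{1}PP mxE; apply: eq_bigr => j _.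
  by rewrite normCK; congr (_ * _); rewrite -{1}hP !mxE.
have P0 k : 0 <= P k k by rewrite PE sumr_ge0 // => j _; rewrite exprn_ge0.
apply: weighted_sum_le_prefix => // [k|].
  rewrite P0 /=; have [//|] := real_leP (ger0_real (P0 k)) (ger0_real ler01).
  move=> P1; have : P k k * P k k <= P k k.
    rewrite {3}PE (bigD1 k) //= ger0_norm ?P0 // expr2 lerDl.
    by rewrite sumr_ge0 // => j _; rewrite exprn_ge0.
  by rewrite ger_pMr ?(lt_trans ltr01) // => /le_lt_trans/(_ P1); rewrite ltxx.
have -> : \sum_k P k k = r%:R.
  by rewrite -[LHS]/(\tr P) mxtrace_mulC (unitarymxP uY) mxtrace1.
by rewrite ler_nat.
Qed.

Definition slice p m q (A : tensor C p m q) (j : 'I_m) : 'M[C]_(p, q) :=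
  \matrix_(i, k) A i j k.

(** Compress the tensor in its first mode to the span of the top [n]
    eigenvectors of the first Gram matrix.  The compressed slices carry mass
    [\sum_(i < n) g i] and their rows span at most [m * n] dimensions; by Ky Fan
    the second Gram matrix holds no more than [\sum_(i < m * n) t i] there. *)
Lemma prefix_sums_le p m q n (A : tensor C p m q) (g t : nat -> C) :
  char_poly (\sum_j slice A j *m (slice A j) ^t*) = \prod_(i < p) ('X - (g i)%:P) ->
  char_poly (\sum_j (slice A j) ^t* *m slice A j) = \prod_(i < q) ('X - (t i)%:P) ->
  (forall i j, (i <= j)%N -> t j <= t i) -> (forall i, 0 <= t i) -> (n <= p)%N ->
  \sum_(i < n) g i <= \sum_(i < m * n) t i.
Proof.
move=> cg ct td t0 np.
have sumC a b (F : 'I_m -> 'M[C]_(a, b)) : (\sum_j F j) ^t* = \sum_j (F j) ^t*.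
  by rewrite [X in X ^ _]linear_sum /= map_mx_sum.
have h1 : (\sum_j slice A j *m (slice A j) ^t*) ^t* = \sum_j slice A j *m (slice A j) ^t*.
  by rewrite sumC; apply: eq_bigr => j _; rewrite trmx_mul map_mxM trmxCK.
have h2 : (\sum_j (slice A j) ^t* *m slice A j) ^t* = \sum_j (slice A j) ^t* *m slice A j.
  by rewrite sumC; apply: eq_bigr => j _; rewrite trmx_mul map_mxM trmxCK.
have [U uU E1] := hermitian_diagonalization h1 cg.
pose T : 'M[C]_p := pid_mx n *m U; pose W j := T *m slice A j.
pose S := (\sum_j <<W j>>)%MS; pose V := schmidt (row_base S).
have uV : V \is unitarymx by rewrite schmidt_unitarymx ?rank_leq_col.
have WV j : W j *m V ^t* *m V = W j.
  have /submxP[D ->] : (W j <= V)%MS.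
    rewrite eqmx_schmidt_free ?row_base_free // eq_row_base.
    by rewrite (sumsmx_sup j) ?genmxE.
  by rewrite -[D *m V *m _]mulmxA (unitarymxP uV) mulmx1.
have rS : (\rank S <= m * n)%N.
  apply: leq_trans (mxrank_sum_leqif _) _; rewrite /=.
  apply: (@leq_trans (\sum_(j < m) n)); last by rewrite sum_nat_const card_ord.
  apply: leq_sum => j _; rewrite genmxE; apply: leq_trans (mxrankM_maxl _ _) _.
  by apply: leq_trans (mxrankM_maxl _ _) _; rewrite rank_pid_mx.
have -> : \sum_(i < n) g i = \sum_j frob (W j).
  rewrite /frob -raddf_sum /=.
  have -> : \sum_j W j *m (W j) ^t* = T *m (\sum_j slice A j *m (slice A j) ^t*) *m T ^t*.
    rewrite mulmx_sumr mulmx_suml; apply: eq_bigr => j _.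
    by rewrite /W trmx_mul map_mxM !mulmxA.
  rewrite E1 /T trmx_mul map_mxM !mulmxA -[_ *m U *m U ^t*]mulmxA (unitarymxP uU) mulmx1.
  rewrite -[_ *m U *m U ^t*]mulmxA (unitarymxP uU) mulmx1 tr_pid_mx map_pid_mx.
  rewrite mxtrace_mulC mulmxA pid_mx_id // /mxtrace (big_ord_widen _ g np) big_mkcond /=.
  apply: eq_bigr => i _; rewrite mul_mx_diag !mxE eqxx /=.
  by case: ifP; rewrite ?mul1r ?mul0r.
apply: le_trans (ky_fan h2 ct td t0 uV rS).
rewrite mulmx_sumr mulmx_suml raddf_sum; apply: ler_sum => j _ /=.
have -> : frob (W j) = frob (W j *m V ^t*).
  by rewrite /frob !trmx_mul !map_mxM trmxCK !mulmxA WV.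
have -> : V *m ((slice A j) ^t* *m slice A j) *m V ^t* =
    (slice A j *m V ^t*) ^t* *m (slice A j *m V ^t*).
  by rewrite trmx_mul map_mxM trmxCK !mulmxA.
rewrite mxtrace_mulC -/(frob (slice A j *m V ^t*)).
by rewrite -(frob_unitary (slice A j *m V ^t*) uU) /W /T -!mulmxA frob_pid.
Qed.

End KyFan.

(** * Necessary inequalities for feasible pairs *)

Section Transfer.
Variable R : realType.

(** The positive entries of a decreasing sequence form an initial segment, so
    their number marks where it ends. *)
Lemma decr_seqs_gt0 (v : nat -> R) i : decr_seqs v -> (0 < v i) = (i < deg v)%N.
Proof.
move=> [vd v0 vf].
have ex : exists n, ~~ (0 < v n).
  apply/not_existsP => H; apply: infinite_nat; apply: sub_finite_set vf => n _ /=.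
  by have /negP := H n; rewrite negbK => /lt0r_neq0.
pose n := ex_minn ex.
have vn k : (0 < v k) = (k < n)%N.
  rewrite /n; case: ex_minnP => d dP dmin; case: ltnP => kd.
    by apply: contraTT kd => /dmin; rewrite -leqNgt.
  by apply/negbTE; apply: contra dP => /lt_le_trans -> //; apply: vd.
rewrite vn; congr (_ < _)%N; rewrite /deg.
have -> : [set k | 0 < v k] = [set k | k \in [fset x | x in iota 0 n]%fset].
  by apply/seteqP; split=> k /=; rewrite vn !inE /= mem_iota.
rewrite (set_fsetK [fset x | x in iota 0 n]%fset) card_fseq.
by rewrite undup_id ?iota_uniq // size_iota.
Qed.

Lemma decr_seqs_eq0 (v : nat -> R) i : decr_seqs v -> (deg v <= i)%N -> v i = 0.
Proof.
move=> dv; rewrite leqNgt -decr_seqs_gt0 // => vi.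
by have [_ /(_ i)] := dv; rewrite le_eqVlt (negPf vi) orbF => /eqP.
Qed.

(** A real tensor realises the same singular values over either field, and a
    complex realisation is the most general one.  Hence necessity has to be
    proved over the complex numbers only, sufficiency over the reals only. *)
Lemma has_singular_values_of_real K p q (B : 'M[R]_(p, q)) s :
  @has_singular_values R RealScalars p q B s ->
  has_singular_values (map_mx (@scalar_of_real R K) B) s.
Proof.
case: K => /=; first by rewrite map_mx_id.
move=> [sd s0 smin E]; split=> //.
have -> : @conj_transpose R ComplexScalars p q (map_mx (real_complex R) B) =
    map_mx (real_complex R) B^T.
  by apply/matrixP=> i j; rewrite !mxE /= oppr0.
rewrite -map_mxM -map_char_poly /=.
have -> : B *m B^T = B *m @conj_transpose R RealScalars p q B.
  by rewrite /conj_transpose /= map_mx_id.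
rewrite E rmorph_prod /=; apply: eq_bigr => i _.
by rewrite rmorphB /= map_polyX map_polyC.
Qed.

Lemma matricization1_map (S T : Type) (f : S -> T) p m q (A : tensor S p m q) :
  matricization1 (fun i j k => f (A i j k)) = map_mx f (matricization1 A).
Proof.
apply/matrixP=> i jk; case/mxvec_indexP: jk => j k.
by rewrite !mxE !mxvecE !mxE.
Qed.

Lemma matricization12_map (S T : Type) (f : S -> T) p m q (A : tensor S p m q) :
  matricization12 (fun i j k => f (A i j k)) = map_mx f (matricization12 A).
Proof.
apply/matrixP=> ij k; case/mxvec_indexP: ij => i j.
by rewrite !mxE !mxvecE !mxE.
Qed.

Lemma feasible_of_real K m (g t : nat -> R) :
  feasible RealScalars m g t -> feasible K m g t.
Proof.
move=> [dg dt [A [s1 s2]]]; split=> //.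
exists (fun i j k => @scalar_of_real R K (A i j k)).
rewrite matricization1_map matricization12_map.
by split; apply: has_singular_values_of_real.
Qed.

Lemma feasible_complex K m (g t : nat -> R) :
  feasible K m g t -> feasible ComplexScalars m g t.
Proof. by case: K => //; apply: feasible_of_real. Qed.

Lemma gram_matricization1 (F : pzSemiRingType) (c : F -> F) p m q
    (A : tensor F p m q) i i' :
  (matricization1 A *m (map_mx c (matricization1 A))^T) i i' =
  \sum_j \sum_k A i j k * c (A i' j k).
Proof.
rewrite mxE (reindex _ (curry_mxvec_bij m q)) pair_bigA /=.
by apply: eq_bigr => -[j k] _ /=; rewrite !mxE !mxvecE !mxE.
Qed.

Lemma gram_matricization12 (F : pzSemiRingType) (c : F -> F) p m q
    (A : tensor F p m q) k k' :
  ((map_mx c (matricization12 A))^T *m matricization12 A) k k' =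
  \sum_i \sum_j c (A i j k) * A i j k'.
Proof.
rewrite mxE (reindex _ (curry_mxvec_bij p m)) pair_bigA /=.
by apply: eq_bigr => -[i j] _ /=; rewrite !mxE !mxvecE !mxE.
Qed.

Local Open Scope sesquilinear_scope.

Lemma gram1_slices p m q (A : tensor R[i] p m q) :
  matricization1 A *m (matricization1 A) ^t* = \sum_j slice A j *m (slice A j) ^t*.
Proof.
apply/matrixP=> i i'; rewrite summxE -map_trmx gram_matricization1.
by apply: eq_bigr => j _; rewrite mxE; apply: eq_bigr => k _; rewrite !mxE.
Qed.

Lemma gram12_slices p m q (A : tensor R[i] p m q) :
  (matricization12 A) ^t* *m matricization12 A = \sum_j (slice A j) ^t* *m slice A j.
Proof.
apply/matrixP=> k k'; rewrite summxE -map_trmx gram_matricization12 exchange_big.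
by apply: eq_bigr => j _; rewrite mxE; apply: eq_bigr => i _; rewrite !mxE.
Qed.

(** Both Gram matrices of [A] have the squared singular values as eigenvalues,
    padded with zeros to their respective sizes. *)
Lemma char_poly_gram p q (A : 'M[R[i]]_(p, q)) (s : nat -> R) :
  @has_singular_values R ComplexScalars p q A s ->
  char_poly (A *m A ^t*) = \prod_(i < p) ('X - ((s i ^+ 2)%:C%C)%:P) /\
  char_poly (A ^t* *m A) = \prod_(i < q) ('X - ((s i ^+ 2)%:C%C)%:P).
Proof.
move=> [_ _ s0 E].
have E1 : char_poly (A *m A ^t*) = \prod_(i < p) ('X - ((s i ^+ 2)%:C%C)%:P).
  by rewrite -map_trmx; exact: E.
split=> //; apply: (char_poly_mulmxC_prod (s := fun i => (s i ^+ 2)%:C%C)) E1.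
by move=> i /s0 ->; rewrite expr0n.
Qed.

Lemma trace_char_poly (C : numClosedFieldType) n (M : 'M[C]_n) (s : nat -> C) :
  M ^t* = M -> char_poly M = \prod_(i < n) ('X - (s i)%:P) ->
  \tr M = \sum_(i < n) s i.
Proof.
move=> hM /(hermitian_diagonalization hM)[U uU ->].
rewrite mxtrace_mulC mulmxA (unitarymxP uU) mul1mx.
by apply: eq_bigr => i _; rewrite !mxE eqxx.
Qed.

Lemma sum_widen0 (f : nat -> R) a b : (a <= b)%N ->
  (forall i, (a <= i)%N -> f i = 0) -> \sum_(i < b) f i = \sum_(i < a) f i.
Proof.
move=> ab f0; rewrite (big_ord_widen b f ab) [RHS]big_mkcond /=.
by apply: eq_bigr => i _; case: ltnP => // /f0.
Qed.

Lemma ler_sum_prefix (f : nat -> R) a b : (a <= b)%N -> (forall i, 0 <= f i) ->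
  \sum_(i < a) f i <= \sum_(i < b) f i.
Proof.
move=> ab f0; rewrite (big_ord_widen b f ab) big_mkcond /=.
by apply: ler_sum => i _; case: ifP.
Qed.

(** For [n] beyond [deg g] the left-hand sum has stopped growing, and the two
    Gram matrices have the same trace. *)
Theorem feasible_necessary K m (g t : nat -> R) : feasible K m g t ->
  (forall n, \sum_(i < n) g i ^+ 2 <= \sum_(i < m * n) t i ^+ 2) /\
  \sum_(i < deg g) g i ^+ 2 = \sum_(i < deg t) t i ^+ 2.
Proof.
move=> /feasible_complex[dg dt [A [s1 s2]]].
have [c1 _] := char_poly_gram s1; have [_ c2] := char_poly_gram s2.
have toC (f : nat -> R) a : \sum_(i < a) (f i ^+ 2)%:C%C = (\sum_(i < a) f i ^+ 2)%:C%C.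
  by rewrite rmorph_sum.
have small n : (n <= deg g)%N -> \sum_(i < n) g i ^+ 2 <= \sum_(i < m * n) t i ^+ 2.
  move=> np; rewrite -lecR -!toC.
  have [td t0 _] := dt.
  rewrite gram1_slices in c1; rewrite gram12_slices in c2.
  apply: (prefix_sums_le (g := fun i => (g i ^+ 2)%:C%C)
    (t := fun i => (t i ^+ 2)%:C%C) c1 c2) => // [i j ij|i]; rewrite lecR ?sqr_ge0 //.
  by rewrite ler_sqr ?nnegrE ?td.
split=> [n|].
  have [|/ltnW pn] := leqP n (deg g); first exact: small.
  rewrite (sum_widen0 (f := fun i => g i ^+ 2) pn) => [|i pi]; last first.
    by rewrite (decr_seqs_eq0 dg pi) expr0n.
  apply: le_trans (small _ (leqnn _)) _.
  by apply: (ler_sum_prefix (f := fun i => t i ^+ 2)) => [|i]; rewrite ?leq_mul ?sqr_ge0.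
apply: complexI; rewrite -!toC.
rewrite -(trace_char_poly (s := fun i => (g i ^+ 2)%:C%C) _ c1); last first.
  by rewrite trmx_mul map_mxM trmxCK.
rewrite -(trace_char_poly (s := fun i => (t i ^+ 2)%:C%C) _ c2); last first.
  by rewrite trmx_mul map_mxM trmxCK.
rewrite gram1_slices gram12_slices !raddf_sum; apply: eq_bigr => j _ /=.
exact: mxtrace_mulC.
Qed.
End Transfer.

(** * The Schur-Horn theorem *)

Section SchurHorn.
Variable R : rcfType.
Implicit Types G g : nat -> R.

(** What is left of the diagonal [G] after a rotation in the plane of the
    consecutive coordinates [k] and [k.+1] has split off the entry [x] between
    [G k.+1] and [G k].  The value that replaces these two lies between them as
    well, which keeps the sequence sorted. *)
Definition merge_step G k x (i : nat) : R :=
  if (i < k)%N then G i else if i == k then G k + G k.+1 - x else G i.+1.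

Lemma merge_step_decr G k x :
  (forall i j, (i <= j)%N -> G j <= G i) -> G k.+1 <= x <= G k ->
  forall i j, (i <= j)%N -> merge_step G k x j <= merge_step G k x i.
Proof.
move=> Gd /andP[xl xu].
suff H i : merge_step G k x i.+1 <= merge_step G k x i.
  move=> i j /subnK <-; elim: (j - i)%N => // d IH; rewrite addSn.
  exact: le_trans (H _) IH.
have Gi := Gd i i.+1 (leqnSn _); have Gi1 := Gd i.+1 i.+2 (leqnSn _).
rewrite /merge_step; case: (ltngtP i k) => [ik|ik|ik].
- case: (ltngtP i.+1 k) => [//|ki|ki]; first by lia.
  by subst k; lra.
- by rewrite (ltnNge i.+1) (leqW (ltnW ik)) /= gtn_eqF // leqW.
- by rewrite -ik (ltnNge i.+1) leqnSn /= gtn_eqF //; subst k; lra.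
Qed.

Lemma sum_merge_step G k x j :
  \sum_(i < j) merge_step G k x i =
  if (j <= k)%N then \sum_(i < j) G i else \sum_(i < j.+1) G i - x.
Proof.
elim: j => [|j IH]; first by rewrite !big_ord0.
rewrite big_ord_recr /= IH /merge_step [in RHS]big_ord_recr /=.
case: (ltngtP j k) => [jk|jk|->]; first by [].
  by rewrite [in RHS]big_ord_recr /= addrAC.
by rewrite !big_ord_recr /=; ring.
Qed.

Lemma sum_delta n (F : 'I_n -> R) (k : 'I_n) : \sum_l F l * (l == k)%:R = F k.
Proof.
rewrite (bigD1 k) //= eqxx mulr1 big1 ?addr0 // => l /negPf ->.
by rewrite mulr0.
Qed.

(** The coordinate carrying [x] becomes the first one, so that the rest of the
    diagonal matrix is a block to which an induction can be applied. *)
Lemma merge_rotation n G k x : (k < n)%N -> G k.+1 <= x <= G k ->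
  exists Q : 'M[R]_(1 + n), [/\ Q^T *m Q = 1%:M,
    (Q^T *m diag_mx (\row_(i < 1 + n) G i) *m Q) 0 0 = x &
    drsubmx (Q^T *m diag_mx (\row_(i < 1 + n) G i) *m Q) =
      diag_mx (\row_(i < n) merge_step G k x i)].
Proof.
move=> kn /andP[xl xu].
have [c [s [cs1 csx]]] : exists c s : R,
    c ^+ 2 + s ^+ 2 = 1 /\ c ^+ 2 * G k + s ^+ 2 * G k.+1 = x.
  have [eG|nG] := eqVneq (G k) (G k.+1).
    by exists 1, 0; rewrite expr1n expr0n /=; split; lra.
  have dG : 0 < G k - G k.+1.
    by rewrite subr_gt0 lt_neqAle eq_sym nG (le_trans xl xu).
  exists (Num.sqrt ((x - G k.+1) / (G k - G k.+1))),
         (Num.sqrt ((G k - x) / (G k - G k.+1))).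
  rewrite !sqr_sqrtr ?divr_ge0 ?subr_ge0 ?(le_trans xl xu) //.
  by split; field; rewrite lt0r_neq0.
(* Column [0] of [Q] is the vector [(c, s)] of the plane of [k] and [k.+1],
   column [k.+1] is the orthogonal vector [(- s, c)], and the other columns are
   the remaining unit vectors in order.  Hence column [a] is [X a] times the unit
   vector [U a] plus [Y a] times the unit vector [K]. *)
pose u a := if a == 0%N then k else if (a <= k)%N then a.-1 else
  if a == k.+1 then k else a.
pose X a := if a == 0%N then c else if a == k.+1 then - s else 1.
pose Y a := if a == 0%N then s else if a == k.+1 then c else 0.
have un (a : 'I_(1 + n)) : (u a < n.+1)%N.
  by rewrite /u; case: a => [a /= an]; do 3?case: ifP; lia.
pose U a : 'I_(1 + n) := Ordinal (un a).
have k1n : (k.+1 < 1 + n)%N by [].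
pose K : 'I_(1 + n) := Ordinal k1n.
pose Q : 'M[R]_(1 + n) := \matrix_(l, a) (X a * (l == U a)%:R + Y a * (l == K)%:R).
have QE (w : nat -> R) (a b : 'I_(1 + n)) :
    (Q^T *m diag_mx (\row_(i < 1 + n) w i) *m Q) a b =
    X a * X b * w (u b) *+ (u a == u b) + Y a * Y b * w k.+1.
  have UK d : (U d == K) = false.
    by rewrite -val_eqE /= /u; case: d => [d /= dn]; do 3?case: ifP; lia.
  have KU d : (K == U d) = false by rewrite eq_sym UK.
  rewrite mxE.
  transitivity (\sum_l ((Q l a * w l * X b) * (l == U b)%:R +
                        (Q l a * w l * Y b) * (l == K)%:R)).
    apply: eq_bigr => l _; rewrite mul_mx_diag.
    rewrite [in LHS]mxE [Q^T _ _]mxE [(\row_i _) _ _]mxE [Q l b]mxE; ring.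
  rewrite big_split /= !sum_delta !mxE UK KU eqxx.
  rewrite -[U b == U a]val_eqE /= eq_sym -mulr_natr; ring.
have uE (a b : nat) : (u a == u b) =
   (a == b) || (a == 0%N) && (b == k.+1) || (a == k.+1) && (b == 0%N).
  by rewrite /u; do 6?case: ifP; lia.
exists Q; split.
- have -> : Q^T *m Q = Q^T *m diag_mx (\row_(i < 1 + n) 1) *m Q.
    have -> : diag_mx (\row_(i < 1 + n) 1) = 1%:M :> 'M[R]_(1 + n).
      by apply/matrixP=> i j; rewrite !mxE.
    by rewrite mulmx1.
  apply/matrixP=> a b; rewrite (QE (fun=> 1)) uE !mxE.
  rewrite /X /Y -[a == b]val_eqE /=.
  case: (nat_of_ord a) (nat_of_ord b) => [|a'] [|b'] //=; rewrite ?eqSS.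
  + lra.
  + by case: eqP; rewrite /= => *; rewrite ?mulr1n ?mulr0n; lra.
  + by rewrite andbT; case: eqP; rewrite /= => *; rewrite ?mulr1n ?mulr0n; lra.
  + rewrite andbF orbF; case: (eqVneq a' k) => [->|ak].
      by case: (eqVneq k b') => *; rewrite ?mulr1n ?mulr0n; lra.
    case: (eqVneq a' b') => [<-|_]; last by rewrite ?mulr0n; lra.
    by rewrite (negPf ak) !mulr1n; lra.
- by rewrite QE eqxx mulr1n /X /Y /u /= -csx; ring.
- apply/matrixP=> a b; rewrite [LHS]mxE [LHS]mxE QE uE !mxE -[a == b]val_eqE /=.
  rewrite !add1n !eqSS /= andbF orbF /X /Y /u /= !eqSS.
  case: (eqVneq (a : nat) k) => [->|ak].
    case: (eqVneq k b) => [<-|_]; rewrite ?mulr0n; last by lra.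
    rewrite ltnn !mulr1n /merge_step ltnn eqxx -csx.
    transitivity ((c ^+ 2 + s ^+ 2) * (G k + G k.+1) -
                  (c ^+ 2 * G k + s ^+ 2 * G k.+1)); first by ring.
    by rewrite cs1 mul1r.
  case: (eqVneq (a : nat) b) => [<-|_]; last by rewrite !mulr0n; lra.
  by rewrite (negPf ak) /merge_step (negPf ak) !mulr1n; case: ifP; lra.
Qed.

(** The Schur-Horn theorem.  As [g 0] lies between two consecutive entries of [G],
    a rotation splits it off; the merged sequence still majorises the tail of
    [g], so the induction continues in the complementary block. *)
Theorem schur_horn n (G g : nat -> R) :
  (forall i j, (i <= j)%N -> G j <= G i) -> (forall i j, (i <= j)%N -> g j <= g i) ->
  (forall k, (k <= n)%N -> \sum_(i < k) g i <= \sum_(i < k) G i) ->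
  \sum_(i < n) g i = \sum_(i < n) G i ->
  exists W : 'M[R]_n, W^T *m W = 1%:M /\
    forall i : 'I_n, (W^T *m diag_mx (\row_(l < n) G l) *m W) i i = g i.
Proof.
elim: n => [|n IH] in G g *.
  by move=> _ _ _ _; exists 1%:M; split=> [|[]//]; rewrite trmx1 mulmx1.
move=> Gd gd gG sgG; have g0G : g 0%N <= G 0%N.
  by have := gG 1%N isT; rewrite !big_ord1.
have [n0|n_gt0] := posnP n.
  subst n; exists 1%:M; rewrite trmx1; split=> [|i]; rewrite mul1mx ?mulmx1 //.
  by move: sgG; rewrite !big_ord1 (ord1 i) !mxE eqxx => ->.
(* Were [g 0] below the least entry of [G], so would be every entry of [g],
   contradicting the equality of the sums. *)
have ex : exists k, (k < n)%N && (G k.+1 <= g 0%N).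
  exists n.-1; rewrite prednK // leqnn /=; rewrite leNgt; apply/negP => Gn.
  have : \sum_(i < n.+1) g i < \sum_(i < n.+1) G i; last by rewrite sgG ltxx.
  apply: ltr_sum => [|i _]; first by apply/hasP; exists ord0; rewrite ?mem_index_enum.
  apply: le_lt_trans (gd _ _ (leq0n _)) (lt_le_trans Gn _).
  by apply: Gd; rewrite -ltnS.
pose k := ex_minn ex; have [kn Gk gk] : [/\ (k < n)%N, G k.+1 <= g 0%N & g 0%N <= G k].
  rewrite /k; case: ex_minnP => -[|j] /andP[jn Gj] jmin; split=> //.
  rewrite leNgt; apply/negP => Gg.
  by have := jmin j; rewrite (ltnW jn) (ltW Gg) ltnn => /(_ isT).
have GkB : G k.+1 <= g 0%N <= G k by rewrite Gk gk.
have [Q [QQ Q00 Qdr]] := merge_rotation kn GkB.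
have split1 (f : nat -> R) j : \sum_(i < j.+1) f i = f 0%N + \sum_(i < j) f i.+1.
  by rewrite big_ord_recl.
have [||||W [WW WE]] := IH (merge_step G k (g 0%N)) (fun i => g i.+1).
- exact: merge_step_decr.
- by move=> i j ij; apply: gd.
- move=> j jn; rewrite sum_merge_step; case: leqP => jk.
    apply: ler_sum => i _; apply: le_trans (gd 0%N _ _) _ => //.
    by apply: (le_trans gk); apply: Gd; rewrite (leq_trans (ltnW (ltn_ord i))).
  by have := gG _ (jn : (j.+1 <= n.+1)%N); rewrite split1; lra.
- by rewrite sum_merge_step leqNgt kn /= -sgG split1; lra.
pose B : 'M[R]_(1 + n) := block_mx 1%:M 0 0 W.
have BT : B^T = block_mx 1%:M 0 0 W^T by rewrite tr_block_mx trmx1 !trmx0.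
pose D : 'M[R]_(1 + n) := diag_mx (\row_(l < 1 + n) G l).
suff [H1 H2] : (Q *m B)^T *m (Q *m B) = 1%:M /\
    forall i : 'I_(1 + n), ((Q *m B)^T *m D *m (Q *m B)) i i = g i.
  by exists (Q *m B).
split.
  rewrite trmx_mul -mulmxA [Q^T *m _]mulmxA QQ mul1mx BT /B mulmx_block.
  by rewrite !mulmx0 !mul0mx !addr0 !add0r mulmx1 WW -scalar_mx_block.
move=> i; rewrite trmx_mul.
have -> : B^T *m Q^T *m D *m (Q *m B) = B^T *m (Q^T *m D *m Q) *m B.
  by rewrite !mulmxA.
rewrite -/D in Q00 Qdr; set E := Q^T *m D *m Q in Q00 Qdr *.
rewrite BT /B -[E]submxK !mulmx_block !mulmx0 !mul0mx !addr0 !add0r !mulmx1 !mul1mx Qdr.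
case: (@split_ordP 1 n i) => j ->.
  by rewrite block_mxEul ord1 [LHS]mxE [LHS]mxE -[RHS]Q00; congr (E _ _); apply: val_inj.
by rewrite block_mxEdr WE.
Qed.
End SchurHorn.

(** * Tensors with prescribed singular values *)

Section Construction.
Variable R : realType.

(** Nonsingularity of the Gram matrix bounds the number of positive singular
    values by the other dimension. *)
Lemma has_singular_values_gram p q (B : 'M[R]_(p, q)) (v : nat -> R) :
  decr_seqs v -> deg v = p -> B *m B^T = diag_mx (\row_(i < p) v i ^+ 2) ->
  @has_singular_values R RealScalars p q B v.
Proof.
move=> dv dp E; have [vd v0 _] := dv.
have pq : (p <= q)%N.
  have : \rank (diag_mx (\row_(i < p) v i ^+ 2)) = p.
    apply: mxrank_unit; rewrite unitmxE det_diag unitfE.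
    apply/prodf_neq0 => i _; rewrite mxE expf_neq0 // lt0r_neq0 //.
    by rewrite decr_seqs_gt0 // dp.
  by rewrite -E => <-; apply: leq_trans (mxrankM_maxl _ _) (rank_leq_col _).
split=> // [i|].
  by rewrite (minn_idPl pq) -dp; apply: decr_seqs_eq0.
rewrite /conj_transpose /= map_mx_id // E.
by rewrite (char_poly_diag (fun i => v (nat_of_ord i) ^+ 2)).
Qed.

Lemma has_singular_values_cogram p q (B : 'M[R]_(p, q)) (v : nat -> R) :
  decr_seqs v -> deg v = q -> B^T *m B = diag_mx (\row_(i < q) v i ^+ 2) ->
  @has_singular_values R RealScalars p q B v.
Proof.
move=> dv dq; rewrite -{2}[B]trmxK => /(has_singular_values_gram dv dq)[vd v0 vm].
rewrite /conj_transpose /= map_mx_id // trmxK => E; split=> // [i|].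
  by rewrite minnC; apply: vm.
rewrite /conj_transpose /= map_mx_id //.
by apply: (char_poly_mulmxC_prod (s := fun i => v i ^+ 2)) E => i /vm ->; rewrite expr0n.
Qed.

Lemma sum_block (f : nat -> R) m n :
  \sum_(i < n * m) f i = \sum_(l < n) \sum_(s < m) f (l * m + s)%N.
Proof.
elim: n => [|n IH]; first by rewrite mul0n !big_ord0.
by rewrite mulSnr big_split_ord big_ord_recr /= IH.
Qed.

(** Group [T] into blocks of length [m]: the prefix inequalities say precisely
    that [g] is majorised by the block sums, so Schur-Horn supplies weights
    [W l i ^+ 2] distributing the block sums into [g]. *)
Lemma block_weights m (g T : nat -> R) :
  (forall i j, (i <= j)%N -> T j <= T i) -> (forall i j, (i <= j)%N -> g j <= g i) ->
  (forall n, \sum_(i < n) g i <= \sum_(i < m * n) T i) ->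
  \sum_(i < m) g i = \sum_(i < m ^ 2) T i ->
  exists W : nat -> nat -> R,
    (forall l l', (l < m)%N -> (l' < m)%N ->
       \sum_(i < m) W l i * W l' i = (l == l')%:R) /\
    (forall i, (i < m)%N ->
       \sum_(l < m) W l i ^+ 2 * \sum_(s < m) T (l * m + s)%N = g i).
Proof.
case: m => [|m]; first by move=> *; exists (fun _ _ => 0).
move=> Td gd gT sgT; set M := m.+1.
have [|//|n _||W [WW WE]] := @schur_horn R M (fun l => \sum_(s < M) T (l * M + s)%N) g.
- by move=> i j ij; apply: ler_sum => s _; rewrite Td // leq_add2r leq_mul2r ij orbT.
- by rewrite -sum_block mulnC.
- by rewrite -sum_block sgT.
exists (fun l i => W (inord l) (inord i)); split=> [l l' lm l'm|i im].
  have /matrixP/(_ (inord l) (inord l')) := mulmx1C WW.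
  rewrite !mxE -val_eqE /= !inordK // => <-.
  by apply: eq_bigr => i _; rewrite inord_val !mxE.
have := WE (inord i); rewrite inordK // => <-; rewrite mxE.
apply: eq_bigr => l _; rewrite inord_val mul_mx_diag mxE [W^T _ _]mxE.
by rewrite [(\row_l0 _) _ _]mxE; ring.
Qed.

(** The diagonal of the second Gram matrix consists of the squares of [t] because
    the rows of the orthogonal matrix have norm 1, that of the first of the squares
    of [g] by the choice of the weights. *)
Theorem feasible_sufficient m (g t : nat -> R) : (0 < m)%N ->
  decr_seqs g -> decr_seqs t ->
  (forall i, (m <= i)%N -> g i = 0) -> (forall i, (m ^ 2 <= i)%N -> t i = 0) ->
  (forall n, \sum_(i < n) g i ^+ 2 <= \sum_(i < m * n) t i ^+ 2) ->
  \sum_(i < m) g i ^+ 2 = \sum_(i < m ^ 2) t i ^+ 2 ->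
  feasible RealScalars m g t.
Proof.
move=> m0 dg dt gm tm gt sgt; have [gd g0 _] := dg; have [td t0 _] := dt.
have sq_decr (v : nat -> R) : (forall i, 0 <= v i) ->
    (forall i j, (i <= j)%N -> v j <= v i) ->
    forall i j, (i <= j)%N -> v j ^+ 2 <= v i ^+ 2.
  by move=> v0 vd i j ij; rewrite ler_sqr ?nnegrE ?vd.
have [W [WW WE]] := block_weights (sq_decr t t0 td) (sq_decr g g0 gd) gt sgt.
have pm : (deg g <= m)%N by rewrite leqNgt -decr_seqs_gt0 // gm ?ltxx.
have qm : (deg t <= m ^ 2)%N by rewrite leqNgt -decr_seqs_gt0 // tm ?ltxx.
have divm k : (k < deg t)%N -> (k %/ m < m)%N.
  by move=> kq; rewrite ltn_divLR // mulnn (leq_trans kq).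
(* Every slice [A(_, _, k)] is supported on one cyclic diagonal of the index
   square, and slices of the same residue mod [m] share their diagonal: rows of
   different indices never meet, slices of different residues never meet. *)
pose A : tensor R (deg g) m (deg t) := fun i j k =>
  (t k * W (k %/ m)%N i) * (nat_of_ord j == (i + k) %% m)%N%:R.
have sumA i i' (k k' : 'I_(deg t)) : \sum_j A i j k * A i' j k' =
    t k * t k' * (W (k %/ m)%N i * W (k' %/ m)%N i') *
    (i + k == i' + k' %[mod m])%N%:R.
  rewrite (bigD1 (Ordinal (ltn_pmod (i + k) m0))) //= big1 => [|j].
    by rewrite addr0 /A eqxx /=; ring.
  by rewrite -val_eqE /= /A => /negPf ->; rewrite mulr0 mul0r.
split=> //; exists A; split.
  apply: has_singular_values_gram => //; apply/matrixP => i i'.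
  have := gram_matricization1 id A i i'; rewrite map_mx_id // => ->.
  rewrite exchange_big /= !mxE; under eq_bigr do rewrite sumA eqn_modDr.
  rewrite !modn_small ?(leq_trans (ltn_ord _) pm) // -[i == i']val_eqE /=.
  have [<-|_] := eqVneq (i : nat) i'; last by rewrite big1 // => k _; rewrite mulr0.
  rewrite mulr1n -WE ?(leq_trans _ pm) //.
  transitivity (\sum_(k < m ^ 2) t k ^+ 2 * W (k %/ m)%N i ^+ 2).
    rewrite (sum_widen0 (f := fun k => t k ^+ 2 * W (k %/ m)%N i ^+ 2) qm) => [|k kq].
      by apply: eq_bigr => k _; ring.
    by rewrite (decr_seqs_eq0 dt kq) expr0n mul0r.
  rewrite (sum_block (fun k => t k ^+ 2 * W (k %/ m)%N i ^+ 2)).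
  apply: eq_bigr => l _; rewrite mulr_sumr; apply: eq_bigr => s _.
  by rewrite divnMDl // divn_small // addn0 mulrC.
apply: has_singular_values_cogram => //; apply/matrixP => k k'.
have := gram_matricization12 id A k k'; rewrite map_mx_id // => ->.
rewrite !mxE; under eq_bigr do rewrite sumA eqn_modDl.
(* Rows beyond [deg g] of the full tensor vanish, so cutting them off
   does not affect the second Gram matrix. *)
have tW i : (deg g <= i < m)%N -> t k * W (k %/ m)%N i = 0.
  move=> /andP[gi im]; apply/eqP; rewrite -sqrf_eq0 eq_le sqr_ge0 andbT.
  rewrite exprMn -[leRHS](expr0n R 2) -(decr_seqs_eq0 dg gi) -WE //.
  have km := divm k (ltn_ord k).
  rewrite (bigD1 (Ordinal km)) //= mulrC (bigD1 (Ordinal (ltn_pmod k m0))) //=.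
  rewrite -divn_eq mulrDr -addrA lerDl addr_ge0 //.
    by rewrite mulr_ge0 ?sqr_ge0 ?sumr_ge0 // => *; rewrite sqr_ge0.
  by apply: sumr_ge0 => *; rewrite mulr_ge0 ?sqr_ge0 ?sumr_ge0 // => *; rewrite sqr_ge0.
have [kk|nkk] := eqVneq (k %% m)%N (k' %% m)%N; last first.
  rewrite big1 => [|i _]; last by rewrite mulr0.
  by have [kk|//] := eqVneq k k'; rewrite kk eqxx in nkk.
transitivity (t k * t k' * \sum_(i < m) W (k %/ m)%N i * W (k' %/ m)%N i).
  rewrite mulr_sumr (big_ord_widen m
    (fun i => t k * t k' * (W (k %/ m)%N i * W (k' %/ m)%N i) * 1) pm).
  rewrite big_mkcond /=; apply: eq_bigr => i _; case: ltnP => ip; first by rewrite mulr1.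
  have -> : t k * t k' * (W (k %/ m)%N i * W (k' %/ m)%N i) =
    (t k * W (k %/ m)%N i) * (t k' * W (k' %/ m)%N i) by ring.
  by rewrite tW ?mul0r // ip ltn_ord.
rewrite WW ?divm //; have [kd|nkd] := eqVneq (k %/ m)%N (k' %/ m)%N.
  have -> : k = k' by apply: val_inj; rewrite /= (divn_eq k m) kk kd -divn_eq.
  by rewrite eqxx mulr1.
by rewrite mulr0; have [ek|//] := eqVneq k k'; rewrite ek eqxx in nkd.
Qed.
End Construction.

(** * Cones given by facets *)

Section PolyhedralCones.
Variables (R : realType) (n : nat).
Implicit Types (S : set 'rV[R]_n) (x y v : 'rV[R]_n).

Lemma conic_hull0 S : conic_hull S 0.
Proof.
exists 0%N, (fun=> 0), (fun=> 0); split=> [//|[]//|].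
by rewrite big_ord0.
Qed.

Lemma conic_hull_cons S a v y : S v -> 0 <= a -> conic_hull S y ->
  conic_hull S (a *: v + y).
Proof.
move=> Sv a0 [l [c [w [c0 Sw ->]]]].
exists l.+1, (fun i => oapp c a (unlift ord0 i)), (fun i => oapp w v (unlift ord0 i)).
split=> [i|i|].
- by case: unliftP => [j|] _ /=.
- by case: unliftP => [j|] _ /=.
rewrite big_ord_recl unlift_none; congr (_ + _).
by apply: eq_bigr => i _; rewrite liftK.
Qed.

Lemma ray_refl v : ray v v.
Proof. by exists 1; rewrite ?scale1r. Qed.

Lemma ray_sub v w : ray v w -> ray w `<=` ray v.
Proof.
move=> [c c0 ->] _ [d d0 ->]; exists (d * c); first exact: mulr_ge0.
by rewrite scalerA.
Qed.

Lemma ray_eq v w : w != 0 -> ray v w -> ray v = ray w.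
Proof.
move=> w0 vw; apply/seteqP; split; last exact: ray_sub.
apply: ray_sub; case: vw w0 => c c0 ->; rewrite scaler_eq0 negb_or => /andP[cn0 _].
by exists c^-1; rewrite ?invr_ge0 // scalerA mulVf // scale1r.
Qed.

Section Facets.
Variables (I : finType) (L : I -> 'rV[R]_n -> R) (E : 'rV[R]_n -> R).
Hypothesis L_linear : forall c a x y, L c (a *: x + y) = a * L c x + L c y.
Hypothesis E_linear : forall a x y, E (a *: x + y) = a * E x + E y.

Definition facet_cone : set 'rV[R]_n := [set x | (forall c, 0 <= L c x) /\ E x = 0].

Lemma facet_coneZD a x y : 0 <= a -> facet_cone x -> facet_cone y ->
  facet_cone (a *: x + y).
Proof.
move=> a0 [x0 Ex] [y0 Ey]; split=> [c|].
  by rewrite L_linear addr_ge0 ?mulr_ge0.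
by rewrite E_linear Ex Ey mulr0 addr0.
Qed.

Lemma facet_cone0 : facet_cone 0.
Proof.
have L0 c : L c 0 = 0.
  have := L_linear c 1 0 0; rewrite scaler0 addr0 mul1r => /eqP.
  by rewrite -subr_eq0 opprD addNKr oppr_eq0 => /eqP.
have E0 : E 0 = 0.
  have := E_linear 1 0 0; rewrite scaler0 addr0 mul1r => /eqP.
  by rewrite -subr_eq0 opprD addNKr oppr_eq0 => /eqP.
by split=> // c; rewrite L0.
Qed.

Lemma conic_hull_sub_facet_cone S : S `<=` facet_cone -> conic_hull S `<=` facet_cone.
Proof.
move=> SC _ [l [c [v [c0 Sv ->]]]].
elim/big_ind: _ => [|x y Cx Cy|i _]; first exact: facet_cone0.
  by rewrite -[x]scale1r; apply: facet_coneZD.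
by rewrite -[_ *: _]addr0; apply: facet_coneZD; [|exact: SC|exact: facet_cone0].
Qed.

(** Subtracting the largest admissible multiple of a generator lying in the
    minimal face of [x] makes one more facet inequality tight, so the descent
    ends at [0]. *)
Lemma facet_cone_generated S :
  S `<=` facet_cone ->
  (forall x, facet_cone x -> x != 0 -> exists2 v, S v &
     (exists c, 0 < L c v) /\ (forall c, L c x = 0 -> L c v = 0)) ->
  facet_cone = conic_hull S.
Proof.
move=> SC face; apply/seteqP; split; last exact: conic_hull_sub_facet_cone.
move=> x; have [k] := ubnP #|[pred c | L c x != 0]|.
elim: k x => // k IH x; rewrite ltnS => xk Cx.
have [->|x0] := eqVneq x 0; first exact: conic_hull0.
have [v Sv [[c0 vc0] vx]] := face x Cx x0.
have [Cv Ev] := SC _ Sv; have [Lx Ex] := Cx.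
pose r c := L c x / L c v.
have [c1 /= vc1 c1min] := @arg_minP _ _ I c0 [pred c | 0 < L c v] r vc0.
pose e := r c1.
have e0 : 0 <= e by rewrite divr_ge0 // ltW.
have -> : x = e *: v + (- e *: v + x) by rewrite addrA -scalerDl subrr scale0r add0r.
have Ly c : L c (- e *: v + x) = L c x - e * L c v.
  by rewrite L_linear mulNr addrC.
apply: conic_hull_cons => //; apply: IH; last first.
  split=> [c|]; last by rewrite E_linear Ev Ex mulr0 addr0.
  rewrite Ly subr_ge0; have [vc|] := boolP (0 < L c v).
    by rewrite -ler_pdivlMr //; exact: c1min.
  by rewrite lt_def Cv andbT negbK => /eqP ->; rewrite mulr0.
apply: leq_trans xk; apply: proper_card; apply/properP; split.
  apply/fintype.subsetP => c; rewrite !inE Ly; apply: contra => /eqP xc.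
  by rewrite xc vx // mulr0 subrr.
exists c1; rewrite !inE; first by apply: contraTneq vc1 => /vx ->; rewrite ltxx.
by rewrite Ly /e /r divfK ?subrr ?eqxx // lt0r_neq0.
Qed.

(** [v] spans an extreme ray as soon as the facets through [v] meet in
    [ray v], because both summands of a point of a face lie in that face. *)
Lemma extreme_ray_of_facets v : v != 0 -> facet_cone v ->
  (forall x, facet_cone x -> (forall c, L c v = 0 -> L c x = 0) -> ray v x) ->
  extreme_ray facet_cone (ray v).
Proof.
move=> v0 Cv H; split; first by exists v.
  move=> _ [a a0 ->]; rewrite -[_ *: _]addr0.
  exact: facet_coneZD a0 Cv facet_cone0.
move=> x y Cx Cy [a a0 exy].
have tight c : L c v = 0 -> L c x = 0 /\ L c y = 0.
  move=> Lv; have [[x0 _] [y0 _]] := (Cx, Cy).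
  have : L c x + L c y = 0.
    rewrite -[L c x]mul1r -L_linear scale1r exy -[_ *: _]addr0 L_linear Lv mulr0.
    by rewrite add0r; have := L_linear c (-1) 0 0; rewrite scaler0 addr0 mulN1r addNr.
  by move/eqP; rewrite paddr_eq0 // => /andP[/eqP-> /eqP->].
by split; apply: H => // c /tight[].
Qed.

(** In a decomposition of [w] into multiples of generators, extremality puts each
    nonzero summand on the ray of [w]. *)
Lemma extreme_ray_generator S r : S `<=` facet_cone -> facet_cone = conic_hull S ->
  extreme_ray facet_cone r -> exists2 v, S v & ray v = r.
Proof.
move=> SC gen [[w w0 ->] rC ext].
have /rC : ray w w by exact: ray_refl.
rewrite {1}gen => -[l [c [v [c0 Sv ew]]]].
have [i ci] : exists i, c i *: v i != 0.
  apply/not_existsP => H; move: w0; rewrite ew big1 ?eqxx // => i _.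
  by apply/eqP; rewrite -[_ == _]negbK; apply/negP/H.
have [|||wi _] := ext (c i *: v i) (\sum_(j | j != i) c j *: v j).
- by rewrite -[_ *: _]addr0; apply: facet_coneZD; [|exact: SC|exact: facet_cone0].
- elim/big_ind: _ => [|x y Cx Cy|j _]; first exact: facet_cone0.
    by rewrite -[x]scale1r; apply: facet_coneZD.
  by rewrite -[_ *: _]addr0; apply: facet_coneZD; [|exact: SC|exact: facet_cone0].
- by have := ray_refl w; rewrite {2}ew (bigD1 i).
exists (v i) => //; rewrite (ray_eq ci wi); apply: ray_eq => //.
by exists (c i).
Qed.
End Facets.
End PolyhedralCones.

(** * The cone of prefix inequalities *)

Section SquaredCone.
Variables (R : realType) (m : nat).
Local Notation vec := 'rV[R]_(m + m ^ 2).
Implicit Types x y : vec.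

(** Reading entries beyond the end as 0 makes the last entry of a vector one more
    difference of consecutive entries, and lets prefix sums have any length. *)
Definition entry n (v : 'rV[R]_n) (i : nat) : R := oapp (v 0) 0 (insub i).

Lemma entry_ord n (v : 'rV[R]_n) (i : 'I_n) : entry v i = v 0 i.
Proof. by rewrite /entry valK. Qed.

Lemma entry_big n (v : 'rV[R]_n) i : (n <= i)%N -> entry v i = 0.
Proof. by move=> ni; rewrite /entry insubF // ltnNge ni. Qed.

Lemma entry_linear n a (v w : 'rV[R]_n) i :
  entry (a *: v + w) i = a * entry v i + entry w i.
Proof.
by rewrite /entry; case: insub => [j|] /=; rewrite ?mulr0 ?addr0 // !mxE.
Qed.

Lemma entry0 n i : entry (0 : 'rV[R]_n) i = 0.
Proof. by rewrite /entry; case: insub => [j|] //=; rewrite mxE. Qed.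

Definition gpart x := entry (lsubmx x).
Definition tpart x := entry (rsubmx x).

Lemma gpart_linear a x y i : gpart (a *: x + y) i = a * gpart x i + gpart y i.
Proof. by rewrite /gpart linearP entry_linear. Qed.

Lemma tpart_linear a x y i : tpart (a *: x + y) i = a * tpart x i + tpart y i.
Proof. by rewrite /tpart linearP entry_linear. Qed.

Lemma gpart0 i : gpart 0 i = 0. Proof. by rewrite /gpart raddf0 entry0. Qed.

Lemma tpart0 i : tpart 0 i = 0. Proof. by rewrite /tpart raddf0 entry0. Qed.

Lemma eq_parts x y :
  (forall i, gpart x i = gpart y i) -> (forall i, tpart x i = tpart y i) -> x = y.
Proof.
move=> eg et; rewrite -[x]hsubmxK -[y]hsubmxK; congr row_mx; apply/rowP => i.
  by rewrite -!entry_ord; apply: eg.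
by rewrite -!entry_ord; apply: et.
Qed.

(** At length [m] the prefix inequality becomes the equation [balance x = 0]. *)
Definition facet (c : 'I_m + 'I_(m ^ 2) + 'I_m) x : R :=
  match c with
  | inl (inl i) => gpart x i - gpart x i.+1
  | inl (inr i) => tpart x i - tpart x i.+1
  | inr j => \sum_(i < m * j) tpart x i - \sum_(i < j) gpart x i
  end.

Definition balance x : R := \sum_(i < m) gpart x i - \sum_(i < m ^ 2) tpart x i.

Lemma sum_linear n (f g h : nat -> R) a : (forall i, h i = a * f i + g i) ->
  \sum_(i < n) h i = a * \sum_(i < n) f i + \sum_(i < n) g i.
Proof. by move=> E; rewrite mulr_sumr -big_split; apply: eq_bigr. Qed.

Lemma facet_linear c a x y : facet c (a *: x + y) = a * facet c x + facet c y.
Proof.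
case: c => [[i|i]|j] /=; rewrite ?gpart_linear ?tpart_linear; try ring.
rewrite (sum_linear _ (tpart_linear a x y)).
by rewrite (sum_linear _ (gpart_linear a x y)); ring.
Qed.

Lemma balance_linear a x y : balance (a *: x + y) = a * balance x + balance y.
Proof.
rewrite /balance (sum_linear _ (tpart_linear a x y)).
by rewrite (sum_linear _ (gpart_linear a x y)); ring.
Qed.

Definition squared_cone : set vec := facet_cone facet balance.

Lemma decr_seqs_of_steps n (v : nat -> R) : (forall i, (n <= i)%N -> v i = 0) ->
  (forall i, (i < n)%N -> 0 <= v i - v i.+1) -> decr_seqs v.
Proof.
move=> vn vd.
have step i : v i.+1 <= v i.
  have [/vd|ni] := ltnP i n; first by rewrite subr_ge0.
  by rewrite !vn // leqW.
have decr i j : (i <= j)%N -> v j <= v i.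
  by move=> /subnK <-; elim: (j - i)%N => // d IH; apply: le_trans (step _) IH.
split=> // [i|].
  by rewrite -(vn (maxn i n)) ?leq_maxr // decr ?leq_maxl.
apply: sub_finite_set (finite_II n) => i /=.
by rewrite ltnNge; apply: contraNN => /vn ->.
Qed.

Lemma squared_coneP x : squared_cone x <->
  [/\ decr_seqs (gpart x), decr_seqs (tpart x),
      forall n, \sum_(i < n) gpart x i <= \sum_(i < m * n) tpart x i &
      \sum_(i < m) gpart x i = \sum_(i < m ^ 2) tpart x i].
Proof.
split=> [[fx /eqP]|[[gd _ _] [td _ _] gt e]]; last first.
  split=> [[[i|i]|j]|] /=; rewrite ?subr_ge0; last by rewrite /balance e subrr.
  - exact: gd.
  - exact: td.
  - exact: gt.
rewrite subr_eq0 => /eqP e.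
have dg : decr_seqs (gpart x).
  apply: (@decr_seqs_of_steps m) => i im; first exact: entry_big.
  exact: (fx (inl (inl (Ordinal im)))).
have dt : decr_seqs (tpart x).
  apply: (@decr_seqs_of_steps (m ^ 2)) => i im; first exact: entry_big.
  exact: (fx (inl (inr (Ordinal im)))).
split=> // n; have [nm|mn] := ltnP n m.
  by have := fx (inr (Ordinal nm)); rewrite subr_ge0.
rewrite (sum_widen0 (f := gpart x) mn) => [|i mi]; last exact: entry_big.
have [_ t0 _] := dt.
rewrite e; apply: (ler_sum_prefix (f := tpart x)) => //.
by rewrite -mulnn leq_mul2l mn orbT.
Qed.

(** * The vertices of the cone *)

Definition vertex_g k b a (i : nat) : nat :=
  if (i < k)%N then (m * b)%N else if (i < k + b)%N then a else 0%N.

Definition vertex_t k b a (i : nat) : nat := if (i < m * k + a)%N then b else 0%N.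

Definition vertex k b a : vec :=
  row_mx (\row_i (vertex_g k b a i)%:R) (\row_i (vertex_t k b a i)%:R).

Definition admissible k b a : Prop :=
  [/\ (0 < a)%N, (0 < b <= m)%N, (a <= b * m)%N & (k <= m - b)%N] /\
  (a = (b * m)%N -> k = 0%N).

Lemma sum_vertex_g k b a n : (\sum_(i < n) vertex_g k b a i =
  m * b * minn n k + a * (minn n (k + b) - minn n k))%N.
Proof.
elim: n => [|n IH]; first by rewrite big_ord0 !min0n; lia.
rewrite big_ord_recr /= IH /vertex_g.
have [nk|kn] := ltnP n k.
  have -> : minn n.+1 k = n.+1 by lia.
  have -> : minn n (k + b) = n by lia.
  have -> : minn n.+1 (k + b) = n.+1 by lia.
  by rewrite !subnn mulnS; lia.
have -> : minn n.+1 k = k by lia.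
have [nd|dn] := ltnP n (k + b).
  have -> : minn n.+1 (k + b) = n.+1 by lia.
  by rewrite subSn // mulnS; lia.
have -> : minn n.+1 (k + b) = (k + b)%N by lia.
by rewrite addn0.
Qed.

Lemma sum_vertex_t k b a n : (\sum_(i < n) vertex_t k b a i =
  b * minn n (m * k + a))%N.
Proof.
elim: n => [|n IH]; first by rewrite big_ord0 min0n muln0.
rewrite big_ord_recr /= IH /vertex_t.
case: ltnP => ni.
  have -> : minn n.+1 (m * k + a) = n.+1 by lia.
  by rewrite mulnS addnC.
have -> : minn n.+1 (m * k + a) = (m * k + a)%N by lia.
by rewrite addn0.
Qed.

Section Admissible.
Variables (k b a : nat).
Hypothesis adm : admissible k b a.

Lemma admissible_g : (k + b <= m)%N.
Proof. by have [[_ /andP[_ bm] _ km] _] := adm; lia. Qed.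

Lemma admissible_t : (m * k + a <= m ^ 2)%N.
Proof.
have [[_ _ ab _] _] := adm; have := admissible_g; rewrite -mulnn => kb.
apply: (@leq_trans (m * (k + b))); last by rewrite leq_mul2l kb orbT.
by rewrite mulnDr leq_add2l mulnC.
Qed.

Lemma gpart_vertex i : gpart (vertex k b a) i = (vertex_g k b a i)%:R.
Proof.
rewrite /gpart /vertex row_mxKl; have [im|mi] := ltnP i m.
  by rewrite (entry_ord _ (Ordinal im)) mxE.
have := admissible_g; rewrite entry_big // /vertex_g => kb.
by rewrite !ifF //; lia.
Qed.

Lemma tpart_vertex i : tpart (vertex k b a) i = (vertex_t k b a i)%:R.
Proof.
rewrite /tpart /vertex row_mxKr; have [im|mi] := ltnP i (m ^ 2).
  by rewrite (entry_ord _ (Ordinal im)) mxE.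
have := admissible_t; rewrite entry_big // /vertex_t => ka.
by rewrite !ifF //; lia.
Qed.

Lemma sum_gpart_vertex n : \sum_(i < n) gpart (vertex k b a) i =
  (m * b * minn n k + a * (minn n (k + b) - minn n k))%N%:R.
Proof.
rewrite -sum_vertex_g natr_sum; apply: eq_bigr => i _; exact: gpart_vertex.
Qed.

Lemma sum_tpart_vertex n : \sum_(i < n) tpart (vertex k b a) i =
  (b * minn n (m * k + a))%N%:R.
Proof.
rewrite -sum_vertex_t natr_sum; apply: eq_bigr => i _; exact: tpart_vertex.
Qed.

(** Up to [k] both sides grow at the rate [m * b]; after that the rate on the left
    is [a <= b * m], and both sides stop at the same total. *)
Lemma vertex_prefix n :
  (m * b * minn n k + a * (minn n (k + b) - minn n k) <=
   b * minn (m * n) (m * k + a))%N.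
Proof.
have [[_ _ ab _] _] := adm.
have [nk|kn] := leqP n k.
  have -> : minn n (k + b) = n by lia.
  have -> : minn (m * n) (m * k + a) = (m * n)%N.
    by apply/minn_idPl; rewrite (leq_trans (leq_mul (leqnn m) nk)) ?leq_addr.
  by rewrite subnn muln0 addn0; lia.
have nE : n = (k + (n - k))%N by lia.
set s := (n - k)%N in nE; rewrite {}nE.
have -> : (minn (k + s) (k + b) - k = minn s b)%N by lia.
rewrite mulnDr -addn_minr mulnDr.
have : (a * minn s b <= b * minn (m * s) a)%N; last by lia.
have [ms|ms] := leqP a (m * s).
  by rewrite mulnC leq_mul2r geq_minr orbT.
apply: (@leq_trans (a * s)); first by rewrite leq_mul2l geq_minl orbT.
by rewrite mulnA leq_mul2r ab orbT.
Qed.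

Lemma vertex_squared_cone : squared_cone (vertex k b a).
Proof.
have [[a0 /andP[b0 bm] ab km] _] := adm.
split=> [[[i|i]|j]|] /=.
- rewrite !gpart_vertex subr_ge0 ler_nat /vertex_g; do 4?case: ifP; nia.
- rewrite !tpart_vertex subr_ge0 ler_nat /vertex_t; do 2?case: ifP; lia.
- by rewrite sum_gpart_vertex sum_tpart_vertex subr_ge0 ler_nat vertex_prefix.
rewrite /balance sum_gpart_vertex sum_tpart_vertex.
have kbm := admissible_g; have kam := admissible_t.
have -> : minn m k = k by lia.
have -> : minn m (k + b) = (k + b)%N by lia.
have -> : minn (m ^ 2) (m * k + a) = (m * k + a)%N by lia.
by apply/eqP; rewrite subr_eq0 eqr_nat; apply/eqP; lia.
Qed.

Lemma vertex_neq0 : vertex k b a != 0.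
Proof.
have [[a0 /andP[b0 _] _ _] _] := adm.
apply/eqP => v0; have := tpart_vertex 0; rewrite v0 /vertex_t ltn_addl //.
by rewrite tpart0 => /esym/eqP; rewrite pnatr_eq0; lia.
Qed.
End Admissible.

Definition vertices : set vec :=
  [set v | exists k b a, admissible k b a /\ v = vertex k b a].

Lemma vertices_sub : vertices `<=` squared_cone.
Proof. by move=> _ [k [b [a [adm ->]]]]; apply: vertex_squared_cone. Qed.

Lemma sum_from_deg (f : nat -> R) n : decr_seqs f -> (deg f <= n)%N ->
  \sum_(i < n) f i = \sum_(i < deg f) f i.
Proof. by move=> df dn; apply: sum_widen0 => // i; apply: decr_seqs_eq0. Qed.

Lemma sum_below_deg (f : nat -> R) n : decr_seqs f -> (n < deg f)%N ->
  \sum_(i < n) f i < \sum_(i < deg f) f i.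
Proof.
move=> df nd; have [_ f0 _] := df.
apply: lt_le_trans (ler_sum_prefix nd f0).
by rewrite big_ord_recr /= ltrDl decr_seqs_gt0.
Qed.

(** Let [d] and [N] count the positive entries of the two halves of [x].  If
    [N = m * d], the vertex whose halves are constant on [d] and [m * d] entries
    will do, since all its prefix inequalities are tight.  Otherwise take the
    vertex whose steps end at [k], [d] and [N], where [k] is the last index below
    [d] at which the prefix inequality of [x] is tight: the prefix inequalities of
    this vertex are strict only strictly between [k] and [d], where those of [x]
    are strict too.  It remains to see that [g] drops at [k]. *)
Lemma vertex_in_face x : squared_cone x -> x != 0 -> exists2 v, vertices v &
  (exists c, 0 < facet c v) /\ (forall c, facet c x = 0 -> facet c v = 0).
Proof.
move=> /squared_coneP[dg dt gt e] x0.
have [gd g0 _] := dg; have [td t0 _] := dt.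
set d := deg (gpart x); set N := deg (tpart x).
have dm : (d <= m)%N by rewrite leqNgt -decr_seqs_gt0 // /gpart entry_big ?ltxx.
have Nm : (N <= m ^ 2)%N by rewrite leqNgt -decr_seqs_gt0 // /tpart entry_big ?ltxx.
have {}e : \sum_(i < d) gpart x i = \sum_(i < N) tpart x i.
  by rewrite -(sum_from_deg dg dm) -(sum_from_deg dt Nm).
have Nmd : (N <= m * d)%N.
  by rewrite leqNgt; apply/negP => /(sum_below_deg dt); rewrite -e ltNge gt.
have N_gt0 : (0 < N)%N.
  rewrite lt0n; apply: contraNneq x0 => N0.
  have g00 : gpart x 0%N = 0.
    apply/eqP; rewrite eq_le g0 andbT leNgt decr_seqs_gt0 //; apply/negP => d0.
    have := sum_below_deg dg d0; rewrite big_ord0 -/d e N0 big_ord0 ltxx //.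
  have z0 i : gpart x i = 0 by apply/eqP; rewrite eq_le g0 andbT -g00 gd.
  apply/eqP/eq_parts => i.
    by rewrite z0 gpart0.
  by rewrite (decr_seqs_eq0 dt) -/N ?N0 // tpart0.
have d_gt0 : (0 < d)%N by move: N_gt0 Nmd; case: (d) => //; rewrite muln0; lia.
have m_gt0 : (0 < m)%N by exact: leq_trans d_gt0 dm.
have gdrop i : i.+1 = d -> gpart x i - gpart x i.+1 != 0.
  move=> id; rewrite (@decr_seqs_eq0 _ _ i.+1) // ?id // subr0 lt0r_neq0 //.
  by rewrite decr_seqs_gt0 // -/d -id.
have tdrop i : i.+1 = N -> tpart x i - tpart x i.+1 != 0.
  move=> id; rewrite (@decr_seqs_eq0 _ _ i.+1) // ?id // subr0 lt0r_neq0 //.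
  by rewrite decr_seqs_gt0 // -/N -id.
(* A vertex that ends where [x] ends lies on every facet through [x] as soon as
   [g] drops at [k] and the prefix inequalities that are strict for the vertex are
   strict for [x]. *)
have pick k b a : admissible k b a -> (k + b = d)%N -> (m * k + a = N)%N ->
    ((0 < k)%N -> gpart x k.-1 != gpart x k) ->
    (forall j, (j < m)%N -> (m * b * minn j k + a * (minn j (k + b) - minn j k) !=
       b * minn (m * j) (m * k + a))%N ->
       \sum_(i < m * j) tpart x i != \sum_(i < j) gpart x i) ->
    exists2 v, vertices v &
      (exists c, 0 < facet c v) /\ (forall c, facet c x = 0 -> facet c v = 0).
  move=> adm kbd kaN kdrop jtight; exists (vertex k b a); first by exists k, b, a.
  have [[a0 /andP[b0 bm] ab km] _] := adm.
  split.
    have d1m : (d.-1 < m)%N by rewrite prednK.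
    exists (inl (inl (Ordinal d1m))); rewrite /= !gpart_vertex // subr_gt0 ltr_nat.
    by rewrite /vertex_g prednK //; do 4?case: ifP; lia.
  move=> [[i|i]|j] fx; apply/eqP; apply: contraLR (introT eqP fx) => /=.
  - rewrite !gpart_vertex // subr_eq0 eqr_nat => vi.
    have [id|id] := eqVneq i.+1 d; first exact: gdrop.
    have ik : i.+1 = k.
      by move: vi; rewrite /vertex_g; do 4?case: ifP; lia.
    by rewrite subr_eq0; have := kdrop; rewrite -ik /= => /(_ isT).
  - rewrite !tpart_vertex // subr_eq0 eqr_nat => vi; apply: tdrop.
    by move: vi; rewrite /vertex_t; do 2?case: ifP; lia.
  - rewrite sum_gpart_vertex // sum_tpart_vertex // !subr_eq0 eqr_nat eq_sym.
    exact: jtight.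
have [Nd|NdN] := eqVneq N (m * d)%N.
  apply: (pick 0%N d (m * d)%N); rewrite ?muln0 ?add0n //.
    by split=> //; split; rewrite ?d_gt0 ?muln_gt0 ?m_gt0 ?subn_gt0 // mulnC.
  move=> j jm; rewrite minn0 muln0 add0n subn0 => /eqP[].
  by rewrite -minnMr mulnCA mulnA.
have NmdS : (N < m * d)%N by rewrite ltn_neqAle NdN.
pose tight k := (k < d)%N && (\sum_(i < k) gpart x i == \sum_(i < m * k) tpart x i).
have ex : exists k, tight k by exists 0%N; rewrite /tight d_gt0 muln0 !big_ord0 eqxx.
have bound k : tight k -> (k <= d)%N by move=> /andP[/ltnW].
have [k /andP[kd /eqP ktight] kmax] := ex_maxnP ex bound.
have mkN : (m * k < N)%N.
  rewrite ltnNge; apply/negP => Nk.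
  by have := sum_below_deg dg kd; rewrite ktight -/d e (sum_from_deg dt Nk) ltxx.
have adm : admissible k (d - k) (N - m * k).
  split; last by rewrite mulnBl; lia.
  by split; [|apply/andP; split| |]; lia.
apply: (pick k (d - k)%N (N - m * k)%N) => //; try lia.
(* Were [g] flat across the last tight index [k], the prefix inequalities at
   [k.-1] and [k.+1] would make the blocks of [t] before and after [m * k] equal
   and [k.+1] tight.  Then [k.+1 = d], so that the last entry of the second block
   vanishes because [N < m * d], while the last entry of the first does not. *)
  move=> k_gt0; apply/eqP => flat.
  have gk := gt k.+1; have gk1 := gt k.-1.
  have blk j : \sum_(i < m * j.+1) tpart x i =
      \sum_(i < m * j) tpart x i + \sum_(s < m) tpart x (m * j + s)%N.
    by rewrite mulnSr big_split_ord.
  rewrite big_ord_recr /= ktight blk in gk.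
  have ktight' := ktight; rewrite -(prednK k_gt0) big_ord_recr /= blk in ktight'.
  have tle (s : 'I_m) : tpart x (m * k + s)%N <= tpart x (m * k.-1 + s)%N.
    by apply: td; rewrite leq_add2r leq_mul2l leq_pred orbT.
  have sle : \sum_(s < m) tpart x (m * k + s)%N <=
      \sum_(s < m) tpart x (m * k.-1 + s)%N.
    exact: ler_sum.
  have k1d : k.+1 = d.
    apply/eqP; rewrite eqn_leq kd leqNgt; apply/negP => k1d.
    have /kmax : tight k.+1; last by rewrite ltnn.
    by rewrite /tight k1d big_ord_recr /= blk ktight; apply/eqP; lra.
  have last_m : (m.-1 < m)%N by rewrite prednK.
  have : \sum_(s < m) (tpart x (m * k.-1 + s)%N - tpart x (m * k + s)%N) = 0.
    by rewrite sumrB; lra.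
  move=> /eqP; rewrite psumr_eq0 => [/allP/(_ (Ordinal last_m))|s _]; last first.
    by rewrite subr_ge0.
  rewrite mem_index_enum => /(_ isT) /=; rewrite subr_eq0 => /eqP teq.
  have : 0 < tpart x (m * k.-1 + m.-1)%N.
    rewrite decr_seqs_gt0 // -/N; apply: leq_trans mkN.
    have : (m * k = m + m * k.-1)%N by rewrite -mulnS prednK.
    lia.
  by rewrite teq decr_seqs_gt0 // -/N; move: NmdS; rewrite -k1d mulnS; lia.
move=> j jm; apply: contra => /eqP jt.
have [jk|kj] := leqP j k.
  have -> : minn j (k + (d - k)) = j by lia.
  have -> : minn (m * j) (m * k + (N - m * k)) = (m * j)%N.
    by apply/minn_idPl; rewrite (leq_trans (leq_mul (leqnn m) jk)) ?leq_addr.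
  by rewrite subnn muln0 addn0; apply/eqP; lia.
have [jd|dj] := ltnP j d.
  by have /kmax : tight j; [rewrite /tight jd jt eqxx|rewrite leqNgt kj].
have -> : minn j (k + (d - k)) = d by lia.
have mdj : (m * d <= m * j)%N by rewrite leq_mul2l dj orbT.
have -> : minn (m * j) (m * k + (N - m * k)) = N by lia.
by apply/eqP; rewrite mulnBr; have := mkN; nia.
Qed.

(** The facets through a vertex determine a ray: they make both halves of [x]
    step functions with the same steps as the vertex, the first prefix equality
    links the top step to [t] when [k > 0], and the balance fixes the other. *)
Lemma vertex_face_ray k b a x : admissible k b a -> squared_cone x ->
  (forall c, facet c (vertex k b a) = 0 -> facet c x = 0) -> ray (vertex k b a) x.
Proof.
move=> adm Cx tight; have /squared_coneP[dg dt gt e] := Cx.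
have [[a0 /andP[b0 bm] ab km] _] := adm; have [gd g0 _] := dg; have [td t0 _] := dt.
have kbm := admissible_g adm; have kam := admissible_t adm.
have gstep i : vertex_g k b a i = vertex_g k b a i.+1 -> gpart x i = gpart x i.+1.
  have [im vi|mi _] := ltnP i m; last by rewrite /gpart !entry_big // leqW.
  apply/eqP; rewrite -subr_eq0; apply/eqP.
  by apply: (tight (inl (inl (Ordinal im)))); rewrite /= !gpart_vertex // vi subrr.
have tstep i : vertex_t k b a i = vertex_t k b a i.+1 -> tpart x i = tpart x i.+1.
  have [im vi|mi _] := ltnP i (m ^ 2); last by rewrite /tpart !entry_big // leqW.
  apply/eqP; rewrite -subr_eq0; apply/eqP.
  by apply: (tight (inl (inr (Ordinal im)))); rewrite /= !tpart_vertex // vi subrr.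
have flat (f : nat -> R) i j : (i <= j)%N ->
    (forall l, (i <= l < j)%N -> f l = f l.+1) -> f j = f i.
  move=> /subnK <-; elim: (j - i)%N => // n IH fl.
  by rewrite addSn -fl ?IH // => [l|]; [move=> ?; apply: fl|]; lia.
pose tau := tpart x 0%N; pose N := (m * k + a)%N.
have tE i : tpart x i = tau * (i < N)%N%:R.
  have [iN|Ni] := ltnP i N.
    rewrite mulr1; apply: flat => // l lN; apply: tstep.
    by rewrite /vertex_t !ifT //; lia.
  rewrite mulr0 -(@entry_big (m ^ 2) (rsubmx x) (maxn i (m ^ 2))) ?leq_maxr //.
  apply/esym/flat; rewrite ?leq_maxl // => l lN; apply: tstep.
  by rewrite /vertex_t !ifF //; lia.
have sumt n : \sum_(i < n) tpart x i = tau * (minn n N)%:R.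
  have -> : \sum_(i < n) tpart x i = tau * (\sum_(i < n) (i < N)%N)%:R.
    by rewrite natr_sum mulr_sumr; apply: eq_bigr => i _; apply: tE.
  congr (_ * _%:R); elim: n => [|n IH]; first by rewrite big_ord0 min0n.
  by rewrite big_ord_recr /= IH; case: ltnP; lia.
have gtail i : (k + b <= i)%N -> gpart x i = 0.
  move=> di; rewrite -(@entry_big m (lsubmx x) (maxn i m)) ?leq_maxr //.
  apply/esym/flat; rewrite ?leq_maxl // => l lN; apply: gstep.
  by rewrite /vertex_g !ifF //; lia.
have gmid i : (k <= i < k + b)%N -> gpart x i = gpart x k.
  move=> /andP[ki id]; apply: flat => // l lN; apply: gstep.
  by rewrite /vertex_g; do 4?case: ifP; lia.
have gtop i : (i < k)%N -> gpart x i = m%:R * tau.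
  move=> ik; have -> : gpart x i = gpart x 0%N.
    apply: flat => // l lN; apply: gstep; rewrite /vertex_g !ifT //; lia.
  have m1 : (1 < m)%N by lia.
  have := tight (inr (Ordinal m1)); rewrite /= sum_gpart_vertex // sum_tpart_vertex //.
  have -> : minn 1 k = 1%N by lia.
  have -> : minn 1 (k + b) = 1%N by lia.
  have mN : (m <= N)%N.
    by apply: (@leq_trans (m * k)); rewrite ?leq_addr // leq_pmulr //; lia.
  rewrite muln1 -/N (minn_idPl mN) [(m * b * 1)%N]muln1 subnn muln0 addn0 [(b * m)%N]mulnC.
  rewrite subrr => /(_ erefl).
  by rewrite big_ord1 sumt (minn_idPl mN) => /eqP; rewrite subr_eq0 mulrC => /eqP.
have bg : b%:R * gpart x k = a%:R * tau.
  have : \sum_(i < k + b) gpart x i = tau * N%:R.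
    rewrite -(sum_widen0 (f := gpart x) kbm) // e sumt.
    by rewrite (minn_idPr kam).
  rewrite big_split_ord /=.
  under eq_bigr => i _ do rewrite gtop //.
  under [X in _ + X]eq_bigr => i _ do rewrite gmid ?leq_addr ?ltn_add2l ?ltn_ord //.
  rewrite !sumr_const !card_ord -[_ *+ k]mulr_natr -[_ *+ b]mulr_natr => H.
  have -> : b%:R * gpart x k = tau * N%:R - m%:R * tau * k%:R by rewrite -H; ring.
  by rewrite /N natrD natrM; ring.
have bR : b%:R != 0 :> R by rewrite pnatr_eq0 -lt0n.
exists (tau / b%:R); first by rewrite divr_ge0 ?t0 ?ler0n.
apply: eq_parts => i; rewrite -[_ *: _]addr0.
  rewrite gpart_linear gpart0 addr0 gpart_vertex // /vertex_g.
  have [ik|ki] := ltnP i k; first by rewrite gtop // natrM; field.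
  have [id|di] := ltnP i (k + b); last by rewrite gtail // mulr0.
  by rewrite gmid ?ki //; apply: (mulfI bR); rewrite bg; field.
rewrite tpart_linear tpart0 addr0 tpart_vertex // /vertex_t tE -/N.
by case: (i < N)%N; rewrite ?mulr0 // mulr1 divfK.
Qed.

Theorem squared_cone_vertices : squared_cone = conic_hull vertices.
Proof.
apply: facet_cone_generated; first exact: facet_linear.
- exact: balance_linear.
- exact: vertices_sub.
- exact: vertex_in_face.
Qed.

Theorem extreme_rays_squared_cone :
  [set r | extreme_ray squared_cone r] = [set ray v | v in vertices].
Proof.
apply/seteqP; split=> [r /= er|_ [v [k [b [a [adm ->]]]] <-] /=].
  apply: extreme_ray_generator er; first exact: facet_linear.
  - exact: balance_linear.
  - exact: vertices_sub.
  - exact: squared_cone_vertices.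
apply: extreme_ray_of_facets; first exact: facet_linear.
- exact: balance_linear.
- exact: vertex_neq0.
- exact: vertex_squared_cone.
- by move=> x; apply: vertex_face_ray.
Qed.
End SquaredCone.

(** * Squared feasible pairs *)

Section Translation.
Variables (R : realType).

Lemma zero_extension_big n (v : n.-tuple R) i : (n <= i)%N -> zero_extension v i = 0.
Proof. by move=> ni; rewrite /zero_extension nth_default ?size_tuple. Qed.

Lemma decr_tuplesP n (v : n.-tuple R) : decr_tuples v <-> decr_seqs (zero_extension v).
Proof.
split=> [[/(sortedP 0) vd /(all_nthP 0) v0]|[vd v0 _]].
  apply: (@decr_seqs_of_steps R n) => [i|i im]; first exact: zero_extension_big.
  rewrite subr_ge0 /zero_extension; have [ni|ni] := ltnP i.+1 n.
    by apply: vd; rewrite size_tuple.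
  by rewrite (@nth_default _ _ _ i.+1) ?size_tuple // v0 ?size_tuple.
split; first by apply/(sortedP 0) => i _; apply: vd.
by apply/(all_nthP 0) => i _; apply: v0.
Qed.

Lemma decr_seqs_sqr (v : nat -> R) : decr_seqs v -> decr_seqs (fun i => v i ^+ 2).
Proof.
move=> [vd v0 vf]; split=> [i j ij|i|]; rewrite ?sqr_ge0 //.
  by rewrite ler_sqr ?nnegrE ?vd.
by apply: sub_finite_set vf => i /=; rewrite sqrf_eq0.
Qed.

Lemma decr_seqs_sqrt (v : nat -> R) : decr_seqs v -> decr_seqs (fun i => Num.sqrt (v i)).
Proof.
move=> [vd v0 vf]; split=> [i j ij|i|]; rewrite ?sqrtr_ge0 //.
  by rewrite ler_sqrt ?vd.
by apply: sub_finite_set vf => i /=; apply: contraNneq => ->; rewrite sqrtr0.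
Qed.

Definition sqrt_tuple n (f : nat -> R) : n.-tuple R := [tuple Num.sqrt (f i) | i < n].

Lemma zero_extension_sqrt n (f : nat -> R) : (forall i, (n <= i)%N -> f i = 0) ->
  zero_extension (sqrt_tuple n f) = fun i => Num.sqrt (f i).
Proof.
move=> f0; apply/funext => i; have [ni|ni] := ltnP i n.
  have := tnth_mktuple (fun j : 'I_n => Num.sqrt (f j)) (Ordinal ni).
  by rewrite (tnth_nth 0).
by rewrite zero_extension_big // f0 // sqrtr0.
Qed.

Section Pairs.
Variable m : nat.
Implicit Type gt : m.-tuple R * (m ^ 2).-tuple R.

Lemma gpart_squared_pair gt i : gpart (squared_pair gt) i = zero_extension gt.1 i ^+ 2.
Proof.
rewrite /gpart; have [im|mi] := ltnP i m; last first.
  by rewrite entry_big // zero_extension_big // expr0n.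
rewrite (entry_ord _ (Ordinal im)) !mxE tnth_lshift.
by rewrite (tnth_nth 0).
Qed.

Lemma tpart_squared_pair gt i : tpart (squared_pair gt) i = zero_extension gt.2 i ^+ 2.
Proof.
rewrite /tpart; have [im|mi] := ltnP i (m ^ 2); last first.
  by rewrite entry_big // zero_extension_big // expr0n.
rewrite (entry_ord _ (Ordinal im)) !mxE tnth_rshift.
by rewrite (tnth_nth 0).
Qed.

Lemma squared_pair_sqrt (x : 'rV[R]_(m + m ^ 2)) : squared_cone x ->
  squared_pair (sqrt_tuple m (gpart x), sqrt_tuple (m ^ 2) (tpart x)) = x.
Proof.
move=> /squared_coneP[[_ g0 _] [_ t0 _] _ _].
apply: eq_parts => i.
  by rewrite gpart_squared_pair zero_extension_sqrt ?sqr_sqrtr // => j; apply: entry_big.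
by rewrite tpart_squared_pair zero_extension_sqrt ?sqr_sqrtr // => j; apply: entry_big.
Qed.

Lemma feasible_pairs_sqrt K (x : 'rV[R]_(m + m ^ 2)) : (0 < m)%N -> squared_cone x ->
  @feasible_pairs R K m m (m ^ 2) (sqrt_tuple m (gpart x), sqrt_tuple (m ^ 2) (tpart x)).
Proof.
move=> m_gt0 /squared_coneP[dg dt gt e].
have gm i : (m <= i)%N -> gpart x i = 0 by apply: entry_big.
have tm i : (m ^ 2 <= i)%N -> tpart x i = 0 by apply: entry_big.
have [_ g0 _] := dg; have [_ t0 _] := dt.
have sq (f : nat -> R) n : (forall i, 0 <= f i) ->
    \sum_(i < n) Num.sqrt (f i) ^+ 2 = \sum_(i < n) f i.
  by move=> f0; apply: eq_bigr => i _; rewrite sqr_sqrtr.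
split; rewrite ?decr_tuplesP ?zero_extension_sqrt //=; try exact: decr_seqs_sqrt.
apply/feasible_of_real/feasible_sufficient => // [||i mi|i mi|n|].
- exact: decr_seqs_sqrt.
- exact: decr_seqs_sqrt.
- by rewrite gm ?sqrtr0.
- by rewrite tm ?sqrtr0.
- by rewrite !sq.
- by rewrite !sq.
Qed.

Theorem squared_feasibleE K : (0 < m)%N ->
  @squared_feasible R K m m (m ^ 2) = squared_cone (m := m).
Proof.
move=> m_gt0; apply/seteqP; split=> [_ [gt [dg dt fe] <-]|x Cx]; last first.
  exists (sqrt_tuple m (gpart x), sqrt_tuple (m ^ 2) (tpart x)).
    exact: feasible_pairs_sqrt.
  exact: squared_pair_sqrt.
apply/squared_coneP.
have -> : gpart (squared_pair gt) = fun i => zero_extension gt.1 i ^+ 2.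
  by apply/funext => i; apply: gpart_squared_pair.
have -> : tpart (squared_pair gt) = fun i => zero_extension gt.2 i ^+ 2.
  by apply/funext => i; apply: tpart_squared_pair.
move: dg dt => /decr_tuplesP dg /decr_tuplesP dt.
have [prefix total] := feasible_necessary fe.
split=> //; try exact: decr_seqs_sqr.
have le_deg n (v : n.-tuple R) :
    decr_seqs (zero_extension v) -> (deg (zero_extension v) <= n)%N.
  by move=> dv; rewrite leqNgt -decr_seqs_gt0 // zero_extension_big ?ltxx.
rewrite (sum_widen0 (f := fun i => zero_extension gt.1 i ^+ 2) (le_deg _ _ dg)) => [|i gi].
  rewrite (sum_widen0 (f := fun i => zero_extension gt.2 i ^+ 2) (le_deg _ _ dt)) // => i ti.
  by rewrite (decr_seqs_eq0 dt ti) expr0n.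
by rewrite (decr_seqs_eq0 dg gi) expr0n.
Qed.

(** The zeros of a sorted nonnegative tuple come last, so dropping them shifts
    nothing. *)
Lemma nth_pos_part_sq n (v : n.-tuple R) i : decr_tuples v ->
  nth 0 (pos_part_sq v) i = zero_extension v i ^+ 2.
Proof.
rewrite /decr_tuples /= /pos_part_sq /zero_extension => -[].
elim: (tval v) i => [|x s IH] i; first by rewrite !nth_nil expr0n.
move=> xs /= /andP[x0 s0]; have ss := path_sorted xs.
case: ifP => [_|/negbT nx]; first by case: i => //= i; apply: IH.
have {nx}x00 : x = 0.
  by apply/eqP; apply: contraNT nx => nx; rewrite lt_def nx.
have sE y : y \in s -> y = 0.
  move=> ys; have /= y0 := allP s0 _ ys.
  apply/eqP; rewrite eq_le y0 andbT -[leRHS]x00.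
  by have /allP/(_ _ ys) := order_path_min ge_trans xs.
rewrite [X in nth _ X](_ : _ = [::]) ?nth_nil.
  case: i => [|i] /=; first by rewrite x00 expr0n.
  have [si|si] := ltnP i (size s); first by rewrite (sE _ (mem_nth 0 si)) expr0n.
  by rewrite nth_default // expr0n.
apply: size0nil; rewrite size_map size_filter; apply/eqP; rewrite eqn0Ngt -has_count.
by apply/hasPn => y /sE ->; rewrite ltxx.
Qed.

Lemma eq_from_nth0_pos (s1 s2 : seq R) :
  all (fun y => 0 < y) s1 -> all (fun y => 0 < y) s2 ->
  (forall i, nth 0 s1 i = nth 0 s2 i) -> s1 = s2.
Proof.
move=> /(all_nthP 0) p1 /(all_nthP 0) p2 e.
apply: (@eq_from_nth _ 0) => [|i _]; last exact: e.
have [lt|lt|//] := ltngtP (size s1) (size s2).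
  by have := p2 _ lt; rewrite -e nth_default ?ltxx.
by have := p1 _ lt; rewrite e nth_default ?ltxx.
Qed.

Lemma nth_two_blocks p q (u w : R) i : nth 0 (nseq p u ++ nseq q w) i =
  if (i < p)%N then u else if (i < p + q)%N then w else 0.
Proof.
rewrite nth_cat size_nseq !nth_nseq; case: ltnP => // pi.
by rewrite ltn_subLR.
Qed.

Lemma all_pos_part_sq n (v : n.-tuple R) : all (fun y => 0 < y) (pos_part_sq v).
Proof.
by apply/allP => z /mapP[y]; rewrite mem_filter => /andP[y0 _] ->; rewrite exprn_gt0.
Qed.

(** A sorted nonnegative tuple is recovered from its positive part, so the
    patterns required of the positive parts pin the vertex down. *)
Theorem squared_vertex_pairs K : (0 < m)%N ->
  @squared_pair R m (m ^ 2) @` @vertex_pairs R K m = vertices (m := m).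
Proof.
move=> m_gt0; apply/seteqP; split.
  move=> _ [gt [[dg dt _] [k [a [b [adm1 [adm2 eg et]]]]]] <-].
  have adm : admissible m k b a by split.
  exists k, b, a; split=> //; apply: eq_parts => i.
    rewrite gpart_squared_pair gpart_vertex // -nth_pos_part_sq // eg nth_two_blocks.
    by rewrite /vertex_g; case: ifP => // _; case: ifP.
  rewrite tpart_squared_pair tpart_vertex // -nth_pos_part_sq // et nth_two_blocks.
  by rewrite /vertex_t; case: ltnP => [i1|i1]; [rewrite ifT // ltn_addr|case: ifP].
move=> _ [k [b [a [adm ->]]]]; have Cv := vertex_squared_cone R adm.
have fv := feasible_pairs_sqrt K m_gt0 Cv; have [dg dt _] := fv.
set gt := (_, _) in fv dg dt.
have ev : squared_pair gt = vertex R m k b a by apply: squared_pair_sqrt.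
exists gt => //; split=> //; exists k, a, b.
have [adm1 adm2] := adm; have [a0 /andP[b0 _] _ _] := adm1; split=> //; split=> //.
  apply: eq_from_nth0_pos; first exact: all_pos_part_sq.
    by rewrite all_cat !all_nseq !ltr0n muln_gt0 m_gt0 b0 a0 !orbT.
  move=> i; rewrite nth_pos_part_sq // -gpart_squared_pair ev gpart_vertex // nth_two_blocks.
  by rewrite /vertex_g; case: ifP => // _; case: ifP.
apply: eq_from_nth0_pos; first exact: all_pos_part_sq.
  by rewrite all_cat !all_nseq !ltr0n b0 !orbT.
move=> i; rewrite nth_pos_part_sq // -tpart_squared_pair ev tpart_vertex // nth_two_blocks.
rewrite /vertex_t; case: (ltnP i (m * k)) => [i1|i1]; last by case: ifP.
by rewrite ifT // ltn_addr.
Qed.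
End Pairs.
End Translation.

Theorem corollary5p10 (R : realType) (K : scalar_kind) (m : nat)
    (m_gt0 : (0 < m)%N) :
  @squared_feasible R K m m (m ^ 2) =
    conic_hull (@squared_pair R m (m ^ 2) @` @vertex_pairs R K m) /\
  [set r | extreme_ray (@squared_feasible R K m m (m ^ 2)) r] =
    [set ray v | v in @squared_pair R m (m ^ 2) @` @vertex_pairs R K m].
Proof.
rewrite squared_feasibleE // squared_vertex_pairs //.
by split; [exact: squared_cone_vertices|exact: extreme_rays_squared_cone].
Qed.
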